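(* Let $(\mathfrak g,[\cdot,\cdot],\alpha,d)$ be an object of $\mathbf{HomLieDer}_\alpha$ with $\alpha$ bijective. Then there exists a unique isomorphism $$\Phi:(\mathcal U_{\mathrm m}(\mathfrak g),\mu_U,\alpha_U,D_U)\to\mathcal U^+(\mathfrak g_0)^\alpha=(\mathcal U^+(\mathfrak g_0),\cdot_\alpha,\widetilde\alpha,\widetilde d)$$ in $\mathbf{HomAsDer}_\alpha$ such that $\Phi\circ\iota_U=\iota_0$. Consequently, untwisting the product and derivation on $\mathcal U_{\mathrm m}(\mathfrak g)$ by $\alpha_U^{-1}$, i.e. setting $u\ast v:=\alpha_U^{-1}(uv)$ and $\Delta_U:=\alpha_U^{-1}\circ D_U$, gives an isomorphism of associative algebras with derivations $$(\mathcal U_{\mathrm m}(\mathfrak g),\ast,\Delta_U)\cong(\mathcal U^+(\mathfrak g_0),\widetilde\delta).$$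
   Context: All vector spaces are over a fixed field $\mathbb{K}$ of characteristic $0$. Associative algebras are not required to have units and morphisms are not required to preserve units. A Hom-Lie algebra is a triple $(\mathfrak g,[\cdot,\cdot],\alpha)$ with $[\cdot,\cdot]$ a skew-symmetric bilinear map on the vector space $\mathfrak g$ and $\alpha:\mathfrak g\to\mathfrak g$ linear such that $[\alpha(x),[y,z]]+[\alpha(y),[z,x]]+[\alpha(z),[x,y]]=0$ and $\alpha([x,y])=[\alpha(x),\alpha(y)]$. An $\alpha$-derivation of it is a linear $d$ with $d\alpha=\alpha d$ and $d([x,y])=[d(x),\alpha(y)]+[\alpha(x),d(y)]$. A Hom-nonassociative algebra is a triple $(A,\mu,\alpha)$ with $\mu:A\times A\to A$ bilinear (written $ab$), $\alpha:A\to A$ linear and $\alpha(ab)=\alpha(a)\alpha(b)$; it is Hom-associative if $\alpha(a)(bc)=(ab)\alpha(c)$. An $\alpha$-derivation of it is a linear $D$ with $D\alpha=\alpha D$ and $D(ab)=D(a)\alpha(b)+\alpha(a)D(b)$. $\mathbf{HomLieDer}_\alpha$ (resp. $\mathbf{HomAsDer}_\alpha$): objects are Hom-Lie (resp. Hom-associative) algebras with an $\alpha$-derivation, the twisting map varying with the object; morphisms are linear maps preserving the bracket (resp. product) and commuting with the twisting maps and the derivations. Construction of $\mathcal F_{\mathrm m}(V)$ for a Hom-module $(V,\alpha_V)$ (vector space with linear endomorphism). For $n\ge1$ a weighted $n$-tree is a planar binary tree with $n$ leaves and a nonnegative integer attached to each internal vertex (the one-leaf tree has no internal vertex); $T_n^{\mathrm{wt}}$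 is the set of these. For $\tau\in T_p^{\mathrm{wt}},\sigma\in T_q^{\mathrm{wt}}$, $\tau\vee\sigma\in T_{p+q}^{\mathrm{wt}}$ joins the two roots to a new lowest internal vertex of weight $0$ ($\tau$ left, $\sigma$ right); for $n\ge2$, $\tau[1]$ adds $1$ to the weight of the lowest internal vertex of $\tau\in T_n^{\mathrm{wt}}$. Let $F_{\mathrm{HNAs}}(V)=\bigoplus_{n\ge1}\bigoplus_{\tau\in T_n^{\mathrm{wt}}}V^{\otimes n}_\tau$ with $V^{\otimes n}_\tau$ a copy of $V^{\otimes n}$, and product $\mu_F((x_1\otimes\cdots\otimes x_n)_\tau,(x_{n+1}\otimes\cdots\otimes x_{n+m})_\sigma)=(x_1\otimes\cdots\otimes x_{n+m})_{\tau\vee\sigma}$; let $\alpha_F$ be the linear map with $\alpha_F|_V=\alpha_V$ and $\alpha_F((x_1\otimes\cdots\otimes x_n)_\tau)=(x_1\otimes\cdots\otimes x_n)_{\tau[1]}$ for $n\ge2$. Let $M_1$ be the two-sided ideal generated by all $\alpha_F(uv)-\alpha_F(u)\alpha_F(v)$, $M_{n+1}$ the two-sided ideal generated by $M_n\cup\alpha_F(M_n)$, $M_\infty=\bigcup_{n\ge1}M_n$. Then $\mathcal F_{\mathrm m}(V)=F_{\mathrm{HNAs}}(V)/M_\infty$ with induced product $\mu_{\mathrm m}$ and twisting map $\alpha_{\mathrm m}$; $j:V\to\mathcal F_{\mathrm m}(V)$ is the inclusion of $V$ (the $n=1$ summand) followed by the quotient map. It is the free Hom-nonassociative algebra on $(V,\alpha_V)$.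 Construction of $\mathcal U_{\mathrm m}(\mathfrak g)$. Apply this to $(V,\alpha_V)=(\mathfrak g,\alpha)$. $\widehat d:\mathcal F_{\mathrm m}(\mathfrak g)\to\mathcal F_{\mathrm m}(\mathfrak g)$ is the unique linear map with $\widehat dj=jd$, $\widehat d\alpha_{\mathrm m}=\alpha_{\mathrm m}\widehat d$, $\widehat d(xy)=\widehat d(x)\alpha_{\mathrm m}(y)+\alpha_{\mathrm m}(x)\widehat d(y)$. $I$ is the two-sided ideal of $\mathcal F_{\mathrm m}(\mathfrak g)$ generated by all $\alpha_{\mathrm m}(u)(vw)-(uv)\alpha_{\mathrm m}(w)$ ($u,v,w\in\mathcal F_{\mathrm m}(\mathfrak g)$) and all $j([x,y])-(j(x)j(y)-j(y)j(x))$ ($x,y\in\mathfrak g$). It satisfies $\alpha_{\mathrm m}(I)\subseteq I$, $\widehat d(I)\subseteq I$. $\mathcal U_{\mathrm m}(\mathfrak g):=\mathcal F_{\mathrm m}(\mathfrak g)/I$ with quotient map $\pi_I$; $\mu_U,\alpha_U,D_U$ are the maps induced by $\mu_{\mathrm m},\alpha_{\mathrm m},\widehat d$; $\iota_U:=\pi_I\circ j$. This is an object of $\mathbf{HomAsDer}_\alpha$, and $\alpha_U$ is bijective when $\alpha$ is. Construction of $\mathcal U^+(\mathfrak g_0)^\alpha$ (for $\alpha$ bijective). Put $[x,y]_0:=\alpha^{-1}([x,y])$, $\delta:=\alpha^{-1}\circ d$; then $\mathfrak g_0:=(\mathfrak g,[\cdot,\cdot]_0)$ is a Lie algebra with derivation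 $\delta$. $\mathcal U^+(\mathfrak g_0):=T^+(\mathfrak g)/J_0$, where $T^+(\mathfrak g)=\bigoplus_{n\ge1}\mathfrak g^{\otimes n}$ and $J_0$ is the two-sided ideal generated by all $x\otimes y-y\otimes x-[x,y]_0$; $\iota_0:\mathfrak g_0\to\mathcal U^+(\mathfrak g_0)$ is the canonical map. $\widetilde\alpha$ and $\widetilde\delta$ are the unique algebra automorphism and derivation of $\mathcal U^+(\mathfrak g_0)$ with $\widetilde\alpha\iota_0=\iota_0\alpha$, $\widetilde\delta\iota_0=\iota_0\delta$; they commute. Put $a\cdot_\alpha b:=\widetilde\alpha(ab)$ and $\widetilde d:=\widetilde\alpha\circ\widetilde\delta$. Then $\mathcal U^+(\mathfrak g_0)^\alpha:=(\mathcal U^+(\mathfrak g_0),\cdot_\alpha,\widetilde\alpha,\widetilde d)$ is an object of $\mathbf{HomAsDer}_\alpha$. *)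

(* Defs.v *)
From HB Require Import structures.
From mathcomp Require Import all_boot all_algebra.
From mathcomp Require Import boolp.

Set Implicit Arguments.
Unset Strict Implicit.
Unset Printing Implicit Defensive.

Import GRing.Theory.

Local Open Scope ring_scope.
Local Open Scope quotient_scope.

Record subspace (K : fieldType) (V : lmodType K) := Subspace {
  in_subspace :> V -> Prop;
  subspace0 : in_subspace 0;
  subspaceP : forall a x y,
    in_subspace x -> in_subspace y -> in_subspace (a *: x + y) }.

Section SubspacePred.
Variables (K : fieldType) (V : lmodType K) (I : subspace V).

Definition subspace_pred : {pred V} := fun x => `[< I x >].

Fact subspace_pred_closed : submod_closed subspace_pred.
Proof.
split; first by apply/asboolP/subspace0.
by move=> a x y /asboolP Ix /asboolP Iy; apply/asboolP/subspaceP.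
Qed.

HB.instance Definition _ := GRing.isSubmodClosed.Build K V subspace_pred
  subspace_pred_closed.

Lemma subspaceD x y : I x -> I y -> I (x + y).
Proof. by move=> Ix Iy; rewrite -[x]scale1r; apply: subspaceP. Qed.

Lemma subspaceZ a x : I x -> I (a *: x).
Proof. by move=> Ix; rewrite -[_ *: _]addr0; apply/subspaceP/subspace0. Qed.

End SubspacePred.

Section LinearQuotient.
Variables (K : fieldType) (V : lmodType K).

Definition lquot (I : subspace V) := Quotient.quot (subspace_pred I).

Variable I : subspace V.

HB.instance Definition _ := Choice.on (lquot I).
HB.instance Definition _ := GRing.Zmodule.on (lquot I).

Definition qpi (x : V) : lquot I := \pi_(lquot I) x.

Definition qlift (W : Type) (f : V -> W) (u : lquot I) : W := f (repr u).

Lemma qpi_surj (u : lquot I) : exists x, u = qpi x.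
Proof. by exists (repr u); rewrite /qpi reprK. Qed.

Lemma qpi_eqP x y : qpi x = qpi y <-> I (x - y).
Proof.
have E : (x - y \in subspace_pred I) = (qpi x == qpi y).
  by rewrite Quotient.idealrBE.
by split=> [/eqP|Ixy]; [rewrite -E => /asboolP | apply/eqP; rewrite -E; apply/asboolP].
Qed.

Lemma repr_qpi x : I (repr (qpi x) - x).
Proof. by rewrite -qpi_eqP /qpi reprK. Qed.

Definition qscale (a : K) (u : lquot I) : lquot I := qpi (a *: repr u).

Lemma qpiB : {morph qpi : x y / x - y}. Proof. exact: raddfB. Qed.
Lemma qpiD : {morph qpi : x y / x + y}. Proof. exact: raddfD. Qed.

Lemma qpiZ a x : qpi (a *: x) = qscale a (qpi x).
Proof.
by apply: esym; apply/qpi_eqP; rewrite -scalerBr; apply/subspaceZ/repr_qpi.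
Qed.

Fact qscaleA a b u : qscale a (qscale b u) = qscale (a * b) u.
Proof. by have [x ->] := qpi_surj u; rewrite -!qpiZ scalerA. Qed.

Fact qscale1 u : qscale 1 u = u.
Proof. by have [x ->] := qpi_surj u; rewrite -!qpiZ scale1r. Qed.

Fact qscaleDr a : {morph qscale a : u v / u + v}.
Proof.
move=> u v; have [x ->] := qpi_surj u; have [y ->] := qpi_surj v.
by rewrite -qpiD -!qpiZ scalerDr qpiD.
Qed.

Fact qscaleDl u : {morph qscale^~ u : a b / a + b}.
Proof.
by move=> a b /=; have [x ->] := qpi_surj u; rewrite -!qpiZ scalerDl qpiD.
Qed.

HB.instance Definition _ := GRing.Zmodule_isLmodule.Build K (lquot I)
  qscaleA qscale1 qscaleDr qscaleDl.

Fact qpi_is_linear : linear qpi.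
Proof. by move=> a x y; rewrite qpiD qpiZ. Qed.

HB.instance Definition _ := GRing.isLinear.Build K V (lquot I) *:%R qpi
  qpi_is_linear.

Lemma qpiP a x y : qpi (a *: x + y) = a *: qpi x + qpi y.
Proof. exact: qpi_is_linear. Qed.

Lemma qpi_eq0 x : I x -> qpi x = 0.
Proof.
move=> Ix; have -> : 0 = qpi 0 by rewrite linear0.
by apply/qpi_eqP; rewrite subr0.
Qed.

Lemma qlift_qpi (W : lmodType K) (f : V -> W) : linear f ->
  (forall x, I x -> f x = 0) -> forall x, qlift f (qpi x) = f x.
Proof.
move=> lf f0 x; pose F := GRing.isLinear.Build K V W *:%R f lf.
pose f' : {linear V -> W} := HB.pack f F.
apply/eqP; rewrite -subr_eq0 /qlift -[f]/(f' : V -> W) -raddfB /=; apply/eqP.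
exact/f0/repr_qpi.
Qed.

Lemma qlift_linear (W : lmodType K) (f : V -> W) : linear f ->
  (forall x, I x -> f x = 0) -> linear (qlift f).
Proof.
move=> lf f0 a u v; have [x ->] := qpi_surj u; have [y ->] := qpi_surj v.
by rewrite -qpiP !qlift_qpi ?lf.
Qed.

Section Endo.
Variable f : {linear V -> V}.

Definition stable := forall x, I x -> I (f x).

Hypothesis fI : stable.

Definition qmap (_ : stable) : lquot I -> lquot I := qlift (qpi \o f).

Lemma qmap_qpi x : qmap fI (qpi x) = qpi (f x).
Proof.
rewrite /qmap qlift_qpi //= => [a y z|y Iy]; first by rewrite /= linearP qpiP.
exact/qpi_eq0/fI.
Qed.

Fact qmap_is_linear : linear (qmap fI).
Proof.
move=> a u v; have [x ->] := qpi_surj u; have [y ->] := qpi_surj v.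
by rewrite -qpiP !qmap_qpi linearP qpiP.
Qed.

HB.instance Definition _ := GRing.isLinear.Build K (lquot I) (lquot I) *:%R
  (qmap fI) qmap_is_linear.
End Endo.

Section Mul.
Variable mu : {bilinear V -> V -> V}.

Definition is_ideal := forall x y, I x -> I (mu x y) /\ I (mu y x).

Hypothesis muI : is_ideal.

Definition qmul (_ : is_ideal) (u v : lquot I) : lquot I :=
  qpi (mu (repr u) (repr v)).

Lemma qmul_qpi x y : qmul muI (qpi x) (qpi y) = qpi (mu x y).
Proof.
apply/qpi_eqP; set x' := repr _; set y' := repr _.
have -> : mu x' y' - mu x y = mu (x' - x) y' + mu x (y' - y).
  by rewrite linearBl linearBr addrA subrK.
apply: subspaceD; first by have [] := @muI (x' - x) y' (repr_qpi x).
by have [] := @muI (y' - y) x (repr_qpi y).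
Qed.

Fact qmul_is_bilinear : bilinear_for *:%R *:%R (qmul muI).
Proof.
split=> w a u v; have [x ->] := qpi_surj u; have [y ->] := qpi_surj v;
  have [z ->] := qpi_surj w; rewrite -qpiP !qmul_qpi -qpiP; congr qpi.
  by rewrite linearDl linearZl_LR.
by rewrite linearPr.
Qed.

HB.instance Definition _ := bilinear_isBilinear.Build K
  (lquot I) (lquot I) (lquot I) *:%R *:%R (qmul muI) qmul_is_bilinear.
End Mul.

End LinearQuotient.

Arguments qpi {K V} I x.

Section Generated.
Variables (K : fieldType) (V : lmodType K).

Inductive in_span (S : V -> Prop) : V -> Prop :=
| span_gen x of S x : in_span S x
| span0 : in_span S 0
| spanP a x y of in_span S x & in_span S y : in_span S (a *: x + y).

Definition span S := Subspace (span0 S) (@spanP S).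

Variable mu : {bilinear V -> V -> V}.

Inductive in_ideal (S : V -> Prop) : V -> Prop :=
| ideal_gen x of S x : in_ideal S x
| ideal0 : in_ideal S 0
| idealP a x y of in_ideal S x & in_ideal S y : in_ideal S (a *: x + y)
| idealMl x y of in_ideal S y : in_ideal S (mu x y)
| idealMr x y of in_ideal S x : in_ideal S (mu x y).

Definition ideal S := Subspace (ideal0 S) (@idealP S).

Lemma ideal_is_ideal S : is_ideal (ideal S) mu.
Proof. by move=> x y Sx; split; [apply: idealMr | apply: idealMl]. Qed.

End Generated.

Section DirectSum.
Variables (K : fieldType) (I : eqType) (M : I -> lmodType K).

Record dsum := DSum {
  dsfun :> forall i, M i;
  dsum_supp : exists s : seq I, forall i, i \notin s -> dsfun i = 0 }.

Lemma dsumP (u v : dsum) : (forall i, u i = v i) -> u = v.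
Proof.
case: u v => [u Hu] [v Hv] /= uv; have {}uv : u = v by apply: functional_extensionality_dep.
by rewrite -uv in Hv *; rewrite (Prop_irrelevance Hu Hv).
Qed.

HB.instance Definition _ := gen_eqMixin dsum.
HB.instance Definition _ := gen_choiceMixin dsum.

Fact dsum0_subproof : exists s : seq I, forall i, i \notin s -> 0 = 0 :> M i.
Proof. by exists [::]. Qed.
Definition dsum0 := DSum dsum0_subproof.

Fact dsumN_subproof (u : dsum) :
  exists s : seq I, forall i, i \notin s -> - u i = 0.
Proof. by have [s su] := dsum_supp u; exists s => i /su ->; rewrite oppr0. Qed.
Definition dsumN u := DSum (dsumN_subproof u).

Fact dsumD_subproof (u v : dsum) :
  exists s : seq I, forall i, i \notin s -> u i + v i = 0.
Proof.
have [s su] := dsum_supp u; have [r rv] := dsum_supp v; exists (s ++ r) => i.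
by rewrite mem_cat negb_or => /andP [/su -> /rv ->]; rewrite addr0.
Qed.
Definition dsumD u v := DSum (dsumD_subproof u v).

Fact dsumZ_subproof (a : K) (u : dsum) :
  exists s : seq I, forall i, i \notin s -> a *: u i = 0.
Proof. by have [s su] := dsum_supp u; exists s => i /su ->; rewrite scaler0. Qed.
Definition dsumZ a u := DSum (dsumZ_subproof a u).

Fact dsum_addA : associative dsumD.
Proof. by move=> u v w; apply: dsumP => i; apply: addrA. Qed.
Fact dsum_addC : commutative dsumD.
Proof. by move=> u v; apply: dsumP => i; apply: addrC. Qed.
Fact dsum_add0 : left_id dsum0 dsumD.
Proof. by move=> u; apply: dsumP => i; apply: add0r. Qed.
Fact dsum_addN : left_inverse dsum0 dsumN dsumD.
Proof. by move=> u; apply: dsumP => i; apply: addNr. Qed.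

HB.instance Definition _ := GRing.isZmodule.Build dsum
  dsum_addA dsum_addC dsum_add0 dsum_addN.

Fact dsum_scaleA a b u : dsumZ a (dsumZ b u) = dsumZ (a * b) u.
Proof. by apply: dsumP => i; apply: scalerA. Qed.
Fact dsum_scale1 u : dsumZ 1 u = u.
Proof. by apply: dsumP => i; apply: scale1r. Qed.
Fact dsum_scaleDr a : {morph dsumZ a : u v / u + v}.
Proof. by move=> u v; apply: dsumP => i; apply: scalerDr. Qed.
Fact dsum_scaleDl u : {morph dsumZ^~ u : a b / a + b}.
Proof. by move=> a b; apply: dsumP => i; apply: scalerDl. Qed.

HB.instance Definition _ := GRing.Zmodule_isLmodule.Build K dsum
  dsum_scaleA dsum_scale1 dsum_scaleDr dsum_scaleDl.

Lemma dsumPE a (u v : dsum) i : (a *: u + v) i = a *: u i + v i.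
Proof. by []. Qed.

Definition dinj_fun i (x : M i) j : M j :=
  match i =P j with
  | ReflectT e => eq_rect i (fun k => M k : Type) x j e
  | ReflectF _ => 0
  end.

Lemma dinj_fun_id i x : @dinj_fun i x i = x.
Proof. by rewrite /dinj_fun; case: eqP => // e; rewrite eq_axiomK. Qed.

Lemma dinj_fun_neq i x j : i != j -> @dinj_fun i x j = 0.
Proof. by rewrite /dinj_fun; case: eqP. Qed.

Fact dinj_subproof i (x : M i) :
  exists s : seq I, forall j, j \notin s -> dinj_fun x j = 0.
Proof. by exists [:: i] => j; rewrite inE eq_sym => /dinj_fun_neq. Qed.
Definition dinj i (x : M i) := DSum (dinj_subproof x).

Fact dinj_is_linear i : linear (@dinj i).
Proof.
move=> a x y; apply: dsumP => j; rewrite dsumPE /=.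
rewrite /dinj_fun; case: eqP => [e|_]; last by rewrite scaler0 addr0.
by case: j / e.
Qed.

HB.instance Definition _ i := GRing.isLinear.Build K (M i) dsum *:%R (@dinj i)
  (@dinj_is_linear i).

Definition dsupp (u : dsum) : seq I := undup (projT1 (cid (dsum_supp u))).

Lemma dsuppP u i : i \notin dsupp u -> u i = 0.
Proof. by rewrite /dsupp mem_undup; case: cid => s /= su /su. Qed.

Section Lift.
Variable W : lmodType K.
Implicit Type phi : forall i, M i -> W.

Definition dslift phi (u : dsum) : W := \sum_(i <- dsupp u) phi i (u i).

Lemma dsliftE phi (s : seq I) (u : dsum) : (forall i, phi i 0 = 0) -> uniq s ->
  (forall i, i \notin s -> u i = 0) -> dslift phi u = \sum_(i <- s) phi i (u i).
Proof.
move=> phi0 us su; rewrite /dslift.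
have red (r : seq I) : \sum_(i <- r) phi i (u i) =
    \sum_(i <- [seq i <- r | u i != 0]) phi i (u i).
  rewrite big_filter [RHS]big_mkcond; apply: eq_bigr => i _.
  by case: eqP => //= ->; rewrite phi0.
rewrite red [RHS]red; apply/perm_big/uniq_perm; rewrite ?filter_uniq ?undup_uniq //.
move=> i; rewrite !mem_filter; case: (u i =P 0) => //= /eqP ui.
have -> : i \in s by apply: contraNT ui => /su ->.
by apply: contraNT ui => /dsuppP ->.
Qed.

Lemma dslift_linear phi : (forall i, linear (phi i)) -> linear (dslift phi).
Proof.
move=> lphi a u v.
have phi0 i : phi i 0 = 0.
  by have := lphi i (-1) 0 0; rewrite scaler0 addr0 scaleN1r addNr.
pose s := undup (dsupp u ++ dsupp v).
have su i : i \notin s -> u i = 0.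
  by rewrite mem_undup mem_cat negb_or => /andP [/dsuppP].
have sv i : i \notin s -> v i = 0.
  by rewrite mem_undup mem_cat negb_or => /andP [_ /dsuppP].
rewrite !(@dsliftE _ s) ?undup_uniq //; last first.
  by move=> i si; rewrite /= su // sv // scaler0 addr0.
rewrite scaler_sumr -big_split /=; apply: eq_bigr => i _.
exact: lphi.
Qed.

Lemma dslift_dinj phi : (forall i, linear (phi i)) ->
  forall i (x : M i), dslift phi (dinj x) = phi i x.
Proof.
move=> lphi i x.
have phi0 j : phi j 0 = 0.
  by have := lphi j (-1) 0 0; rewrite scaler0 addr0 scaleN1r addNr.
rewrite (@dsliftE _ [:: i]) ?big_seq1 //= ?dinj_fun_id //.
by move=> j; rewrite inE eq_sym => /dinj_fun_neq ->.
Qed.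

Lemma dslift_comb a (phi psi chi : forall i, M i -> W) :
  (forall i x, phi i x = a *: psi i x + chi i x) ->
  forall u, dslift phi u = a *: dslift psi u + dslift chi u.
Proof.
move=> H u; rewrite /dslift scaler_sumr -big_split /=.
by apply: eq_bigr => i _.
Qed.
End Lift.

Lemma dsum_sumE u : u = \sum_(i <- dsupp u) dinj (u i).
Proof.
apply: dsumP => j.
have pr : {morph (fun v : dsum => v j) : x y / x + y >-> x + y} by [].
rewrite (big_morph (fun v : dsum => v j) pr (erefl _)) /=.
have [js|js] := boolP (j \in dsupp u); last first.
  rewrite (dsuppP js) big_seq big1 // => i iu; apply: dinj_fun_neq.
  by apply: contraNneq js => <-.
rewrite (bigD1_seq j) ?undup_uniq //= dinj_fun_id big1 ?addr0 // => i ij.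
exact: dinj_fun_neq.
Qed.

Lemma dsum_ind (P : dsum -> Prop) : P 0 ->
  (forall i x z, P z -> P (@dinj i x + z)) -> forall u, P u.
Proof.
move=> P0 PD u; rewrite (dsum_sumE u); elim: (dsupp u) => [|i s IH].
  by rewrite big_nil.
by rewrite big_cons; apply: PD.
Qed.

End DirectSum.

(* The free vector space on a set is the direct sum of copies of the field. *)
Section FreeModule.
Variables (K : fieldType) (T : eqType).

Definition freemod := dsum (fun _ : T => K^o : lmodType K).

HB.instance Definition _ := GRing.Lmodule.on freemod.

Definition fgen (t : T) : freemod := @dinj K T (fun _ => K^o) t 1.

Lemma fgenZ a t : @dinj K T (fun _ => K^o) t a = a *: fgen t.
Proof. by rewrite -linearZ /= /GRing.scale /= mulr1. Qed.

Lemma freemod_ind (P : freemod -> Prop) : P 0 ->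
  (forall a t z, P z -> P (a *: fgen t + z)) -> forall z, P z.
Proof.
move=> P0 PD; apply: dsum_ind => // t a z Pz.
by rewrite fgenZ; apply: PD.
Qed.

Section Lift.
Variables (W : lmodType K).
Implicit Type f : T -> W.

Definition flift f : freemod -> W := dslift (fun t (a : K^o) => a *: f t).

Lemma flift_is_linear f : linear (flift f).
Proof.
by apply: dslift_linear => t a x y; rewrite scalerDl scalerA.
Qed.

HB.instance Definition _ f :=
  GRing.isLinear.Build K freemod W *:%R (flift f) (flift_is_linear f).

Lemma flift_fgen f t : flift f (fgen t) = f t.
Proof.
rewrite /flift dslift_dinj ?scale1r // => {}t a x y.
by rewrite scalerDl scalerA.
Qed.
End Lift.
End FreeModule.

(* The tensor power V^{(x) n}: the free vector space on n-tuples modulo the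
   multilinearity relations. *)
Section TensorPower.
Variables (K : fieldType) (V : lmodType K) (n : nat).
Implicit Types (t : n.-tuple V) (i : 'I_n).

(* The i-th entry of t is a t1_i + t2_i; all other entries of the three tuples
   agree. *)
Definition lin_at i (a : K) t t1 t2 :=
  tnth t i = a *: tnth t1 i + tnth t2 i /\
  forall j, j != i -> tnth t1 j = tnth t j /\ tnth t2 j = tnth t j.

Definition multilinear (W : lmodType K) (f : n.-tuple V -> W) :=
  forall i a t t1 t2, lin_at i a t t1 t2 -> f t = a *: f t1 + f t2.

Definition multilin_rel (z : freemod K (n.-tuple V)) :=
  exists i a t t1 t2,
    lin_at i a t t1 t2 /\ z = fgen K t - (a *: fgen K t1 + fgen K t2).

Definition tpow := lquot (span multilin_rel).

HB.instance Definition _ := GRing.Lmodule.on tpow.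

Definition tens t : tpow := qpi (span multilin_rel) (fgen K t).

Lemma tens_multilinear : multilinear tens.
Proof.
move=> i a t t1 t2 Ht; rewrite /tens -qpiP.
by apply/qpi_eqP/span_gen; exists i, a, t, t1, t2.
Qed.

Lemma tpow_ind (P : tpow -> Prop) : P 0 ->
  (forall a t z, P z -> P (a *: tens t + z)) -> forall z, P z.
Proof.
move=> P0 PD z; have [{}z ->] := qpi_surj z.
elim/freemod_ind: z => [|a t z IH]; first by rewrite linear0.
by rewrite qpiP; apply: PD.
Qed.

Section Lift.
Variable W : lmodType K.
Implicit Type f : n.-tuple V -> W.

Definition tlift f : tpow -> W := qlift (flift f).

Lemma flift_span f : multilinear f ->
  forall z, span multilin_rel z -> flift f z = 0.
Proof.
move=> mf z; elim=> {z} [z [i [a [t [t1 [t2 [Ht ->]]]]]]||a x y _ x0 _ y0].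
- by rewrite linearB linearP /= !flift_fgen (mf _ _ _ _ _ Ht) subrr.
- by rewrite linear0.
- by rewrite linearP /= x0 y0 scaler0 addr0.
Qed.

Lemma tlift_tens f : multilinear f -> forall t, tlift f (tens t) = f t.
Proof.
move=> mf t; rewrite /tlift qlift_qpi ?flift_fgen //.
- exact: flift_is_linear.
- exact: flift_span.
Qed.

Lemma tlift_linear f : multilinear f -> linear (tlift f).
Proof.
move=> mf; apply: qlift_linear; first exact: flift_is_linear.
exact: flift_span.
Qed.

Lemma tlift_comb a (f g h : n.-tuple V -> W) :
  (forall t, f t = a *: g t + h t) ->
  forall z, tlift f z = a *: tlift g z + tlift h z.
Proof.
move=> fE z; apply: dslift_comb => t b.
by rewrite fE scalerDr !scalerA mulrC.
Qed.
End Lift.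

End TensorPower.

Section TensorSum.
Variables (K : fieldType) (V : lmodType K) (I : eqType) (deg : I -> nat).

Definition tsum := dsum (fun i => tpow V (deg i) : lmodType K).

HB.instance Definition _ := GRing.Lmodule.on tsum.

Definition pure i (t : (deg i).-tuple V) : tsum :=
  @dinj K I (fun i => tpow V (deg i)) i (tens t).

Lemma pure_multilinear i : multilinear (@pure i).
Proof.
by move=> k a t t1 t2 Ht; rewrite /pure (tens_multilinear Ht) linearP.
Qed.

Lemma eq_pure i j (s : (deg i).-tuple V) (t : (deg j).-tuple V) :
  i = j -> s = t :> seq V -> pure s = pure t.
Proof. by move=> ij; case: j / ij t => t /val_inj ->. Qed.

Lemma tsum_ind (P : tsum -> Prop) : P 0 ->
  (forall a i t z, P z -> P (a *: @pure i t + z)) -> forall z, P z.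
Proof.
move=> P0 PD; apply: dsum_ind => // i x.
elim/tpow_ind: x => [|a t x IH] z Pz; first by rewrite linear0 add0r.
by rewrite linearP -addrA; apply/PD/IH.
Qed.

Section Lift.
Variable W : lmodType K.
Implicit Type phi : forall i, (deg i).-tuple V -> W.

Definition tslift phi : tsum -> W := dslift (fun i => tlift (phi i)).

Lemma tslift_linear phi : (forall i, multilinear (phi i)) ->
  linear (tslift phi).
Proof. by move=> mphi; apply: dslift_linear => i; apply: tlift_linear. Qed.

Lemma tslift_pure phi : (forall i, multilinear (phi i)) ->
  forall i t, tslift phi (@pure i t) = phi i t.
Proof.
move=> mphi i t; rewrite /tslift dslift_dinj ?tlift_tens // => j.
exact: tlift_linear.
Qed.

Lemma tslift_comb a (phi psi chi : forall i, (deg i).-tuple V -> W) :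
  (forall i t, phi i t = a *: psi i t + chi i t) ->
  forall u, tslift phi u = a *: tslift psi u + tslift chi u.
Proof. by move=> H; apply: dslift_comb => i x; apply: tlift_comb. Qed.
End Lift.

End TensorSum.

Arguments pure {K V I deg} i t.

Section Tuples.
Variables (K : fieldType) (V : lmodType K).

Definition tleft p q (t : (p + q).-tuple V) : p.-tuple V :=
  [tuple tnth t (lshift q i) | i < p].
Definition tright p q (t : (p + q).-tuple V) : q.-tuple V :=
  [tuple tnth t (rshift p i) | i < q].

Lemma tleft_cat p q (s : p.-tuple V) (t : q.-tuple V) :
  tleft (cat_tuple s t) = s.
Proof. by apply: eq_from_tnth => i; rewrite tnth_mktuple tnth_lshift. Qed.

Lemma tright_cat p q (s : p.-tuple V) (t : q.-tuple V) :
  tright (cat_tuple s t) = t.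
Proof. by apply: eq_from_tnth => i; rewrite tnth_mktuple tnth_rshift. Qed.

Lemma cat_tleft_tright p q (t : (p + q).-tuple V) :
  cat_tuple (tleft t) (tright t) = t.
Proof.
apply: eq_from_tnth => i; case: (split_ordP i) => j ->.
  by rewrite tnth_lshift tnth_mktuple.
by rewrite tnth_rshift tnth_mktuple.
Qed.

Lemma lin_at_catl p q i a (t t1 t2 : p.-tuple V) (s : q.-tuple V) :
  lin_at i a t t1 t2 ->
  lin_at (lshift q i) a (cat_tuple t s) (cat_tuple t1 s) (cat_tuple t2 s).
Proof.
case=> Hi Hj; split=> [|j]; first by rewrite !tnth_lshift.
case: (split_ordP j) => k ->; last by rewrite !tnth_rshift.
by rewrite !tnth_lshift eq_lshift => /Hj.
Qed.

Lemma lin_at_catr p q i a (t t1 t2 : q.-tuple V) (s : p.-tuple V) :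
  lin_at i a t t1 t2 ->
  lin_at (rshift p i) a (cat_tuple s t) (cat_tuple s t1) (cat_tuple s t2).
Proof.
case=> Hi Hj; split=> [|j]; first by rewrite !tnth_rshift.
case: (split_ordP j) => k ->; first by rewrite !tnth_lshift.
by rewrite !tnth_rshift eq_rshift => /Hj.
Qed.

Lemma lin_at_split p q i a (t t1 t2 : (p + q).-tuple V) :
  lin_at i a t t1 t2 ->
  (exists k, lin_at k a (tleft t) (tleft t1) (tleft t2) /\
     (tright t1 = tright t /\ tright t2 = tright t)) \/
  (exists k, lin_at k a (tright t) (tright t1) (tright t2) /\
     (tleft t1 = tleft t /\ tleft t2 = tleft t)).
Proof.
case: (split_ordP i) => k -> [Hi Hj]; [left | right]; exists k; split.
- split=> [|j jk]; first by rewrite !tnth_mktuple.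
  by rewrite !tnth_mktuple; apply: Hj; rewrite eq_lshift.
- by split; apply: eq_from_tnth => j; rewrite !tnth_mktuple;
    have [] := Hj (rshift p j); rewrite ?eq_rlshift.
- split=> [|j jk]; first by rewrite !tnth_mktuple.
  by rewrite !tnth_mktuple; apply: Hj; rewrite eq_rshift.
- by split; apply: eq_from_tnth => j; rewrite !tnth_mktuple;
    have [] := Hj (lshift q j); rewrite ?eq_lrshift.
Qed.

Lemma lin_at_map n (f : {linear V -> V}) i a (t t1 t2 : n.-tuple V) :
  lin_at i a t t1 t2 ->
  lin_at i a (map_tuple f t) (map_tuple f t1) (map_tuple f t2).
Proof.
case=> Hi Hj; split=> [|j /Hj [e1 e2]]; first by rewrite !tnth_map Hi linearP.
by rewrite !tnth_map e1 e2.
Qed.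

End Tuples.

(* Weighted planar binary trees; T_n^{wt} consists of the trees with n leaves,
   so that summing over n and then over T_n^{wt} is summing over wtree. *)
Inductive wtree := Leaf | Node (weight : nat) (l r : wtree).

Fixpoint leaves (t : wtree) : nat :=
  if t is Node _ l r then leaves l + leaves r else 1.

Fixpoint wtree_code (t : wtree) : GenTree.tree nat :=
  if t is Node k l r then GenTree.Node k [:: wtree_code l; wtree_code r]
  else GenTree.Leaf 0.

Fixpoint wtree_decode (t : GenTree.tree nat) : wtree :=
  if t is GenTree.Node k [:: l; r] then Node k (wtree_decode l) (wtree_decode r)
  else Leaf.

Fact wtree_codeK : cancel wtree_code wtree_decode.
Proof. by elim=> //= k l -> r ->. Qed.

HB.instance Definition _ := Equality.copy wtree (can_type wtree_codeK).

Section FreeHomNonAssociative.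
Variables (K : fieldType) (V : lmodType K) (aV : {linear V -> V}).

(* pure t x, for t : wtree, is (x_1 (x) ... (x) x_n)_t. *)
Definition HNAs := @tsum K V wtree leaves.

HB.instance Definition _ := GRing.Lmodule.on HNAs.

Implicit Types u v : HNAs.

Definition HNAs_inj (x : V) : HNAs := pure Leaf [tuple x].

Fact HNAs_inj_is_linear : linear HNAs_inj.
Proof.
move=> a x y; apply: (@pure_multilinear K V wtree leaves Leaf ord0).
by split=> // j; rewrite [j]ord1.
Qed.
HB.instance Definition _ := GRing.isLinear.Build K V HNAs *:%R HNAs_inj
  HNAs_inj_is_linear.

Definition HNAs_mul_pure s (x : (leaves s).-tuple V) t (y : (leaves t).-tuple V)
  : HNAs := pure (Node 0 s t) (cat_tuple x y).

Definition HNAs_mul u v : HNAs :=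
  tslift (fun s x => tslift (fun t y => HNAs_mul_pure x y) v) u.

Lemma HNAs_mul_multilinear s x : forall t, multilinear (@HNAs_mul_pure s x t).
Proof.
move=> t i a y y1 y2 H; apply: (@pure_multilinear _ _ _ leaves (Node 0 s t)).
exact: lin_at_catr H.
Qed.

Lemma HNAs_mul_multilinearl v s :
  multilinear (fun x => tslift (fun t y => @HNAs_mul_pure s x t y) v).
Proof.
move=> i a x x1 x2 H; apply: tslift_comb => t y.
apply: (@pure_multilinear _ _ _ leaves (Node 0 s t)).
exact: lin_at_catl H.
Qed.

Lemma HNAs_mulE s x t y :
  HNAs_mul (pure s x) (pure t y) = pure (Node 0 s t) (cat_tuple x y).
Proof.
rewrite /HNAs_mul tslift_pure; last exact: HNAs_mul_multilinearl.
by rewrite tslift_pure //; apply: HNAs_mul_multilinear.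
Qed.

Fact HNAs_mul_is_bilinear : bilinear_for *:%R *:%R HNAs_mul.
Proof.
split=> w a u v; rewrite /HNAs_mul.
  by apply: tslift_linear => s; apply: HNAs_mul_multilinearl.
apply: tslift_comb => s x; apply: tslift_linear => t.
exact: HNAs_mul_multilinear.
Qed.
HB.instance Definition _ := bilinear_isBilinear.Build K HNAs HNAs HNAs
  *:%R *:%R HNAs_mul HNAs_mul_is_bilinear.

(* Raising the root weight is the operation t |-> t[1] on trees. *)
Definition HNAs_tw_pure t : (leaves t).-tuple V -> HNAs :=
  match t with
  | Leaf => fun x => pure Leaf (map_tuple aV x)
  | Node k l r => fun x => pure (Node k.+1 l r) x
  end.

Definition HNAs_tw : HNAs -> HNAs := tslift HNAs_tw_pure.

Lemma HNAs_tw_multilinear t : multilinear (@HNAs_tw_pure t).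
Proof.
case: t => [|k l r] i a x x1 x2 H /=.
  exact: (@pure_multilinear _ _ _ leaves Leaf _ _ _ _ _ (lin_at_map aV H)).
exact: (@pure_multilinear _ _ _ leaves (Node k.+1 l r) i a x x1 x2 H).
Qed.

Lemma HNAs_tw_pureE t x : HNAs_tw (pure t x) = HNAs_tw_pure x.
Proof. by apply: tslift_pure; apply: HNAs_tw_multilinear. Qed.

Lemma HNAs_tw_inj x : HNAs_tw (HNAs_inj x) = HNAs_inj (aV x).
Proof. by rewrite HNAs_tw_pureE; apply: eq_pure. Qed.

Fact HNAs_tw_is_linear : linear HNAs_tw.
Proof. by apply: tslift_linear; apply: HNAs_tw_multilinear. Qed.
HB.instance Definition _ := GRing.isLinear.Build K HNAs HNAs *:%R HNAs_tw
  HNAs_tw_is_linear.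

Lemma HNAs_ind (P : HNAs -> Prop) :
    P 0 -> (forall a u v, P u -> P v -> P (a *: u + v)) ->
    (forall x, P (HNAs_inj x)) ->
    (forall u v, P u -> P v -> P (HNAs_mul u v)) ->
    (forall u, P u -> P (HNAs_tw u)) ->
  forall u, P u.
Proof.
move=> P0 PL Pi PM PT; apply: tsum_ind => // a t x z Pz; apply: PL => // {a z Pz}.
elim: t x => [|k l IHl r IHr] x.
  case/tupleP: x => y x; rewrite [x]tuple0.
  have -> : pure Leaf [tuple of y :: [tuple]] = HNAs_inj y by apply: eq_pure.
  exact: Pi.
elim: k x => [|k IHk] x.
  by rewrite -(cat_tleft_tright (x : (leaves l + leaves r).-tuple V)) -HNAs_mulE;
    apply: PM.
by rewrite -[pure _ _]/(@HNAs_tw_pure (Node k l r) x) -HNAs_tw_pureE; apply: PT.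
Qed.

(* HNAs_M n is M_{n+1}. *)
Fixpoint HNAs_M n : subspace HNAs :=
  ideal HNAs_mul
    (if n is n'.+1 then fun z => HNAs_M n' z \/ exists2 y, HNAs_M n' y & z = HNAs_tw y
     else fun z => exists u v,
       z = HNAs_tw (HNAs_mul u v) - HNAs_mul (HNAs_tw u) (HNAs_tw v)).

Lemma HNAs_M_ideal n : is_ideal (HNAs_M n) HNAs_mul.
Proof. by case: n => [|n]; apply: ideal_is_ideal. Qed.

Lemma HNAs_MS n z : HNAs_M n z -> HNAs_M n.+1 z.
Proof. by move=> Mz; apply: ideal_gen; left. Qed.

Lemma HNAs_M_tw n z : HNAs_M n z -> HNAs_M n.+1 (HNAs_tw z).
Proof. by move=> Mz; apply: ideal_gen; right; exists z. Qed.

Lemma HNAs_M_le m n z : (m <= n)%N -> HNAs_M m z -> HNAs_M n z.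
Proof.
by move=> /subnK <-; elim: (n - m)%N => //= k IH Mz; apply/HNAs_MS/IH.
Qed.

Definition in_Minf z := exists n, HNAs_M n z.

Fact Minf0 : in_Minf 0. Proof. by exists 0%N; apply: subspace0. Qed.

Fact MinfP a x y : in_Minf x -> in_Minf y -> in_Minf (a *: x + y).
Proof.
move=> [m Mx] [n My]; exists (maxn m n).
apply: subspaceP; first exact: HNAs_M_le (leq_maxl _ _) Mx.
exact: HNAs_M_le (leq_maxr _ _) My.
Qed.

Definition Minf := Subspace Minf0 MinfP.

Fact Minf_ideal : is_ideal Minf HNAs_mul.
Proof.
move=> x y [n Mx]; have [Mxy Myx] := @HNAs_M_ideal n x y Mx.
by split; exists n.
Qed.

Fact Minf_tw : stable Minf HNAs_tw.
Proof. by move=> x [n Mx]; exists n.+1; apply: HNAs_M_tw. Qed.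

Lemma Minf_gen u v :
  Minf (HNAs_tw (HNAs_mul u v) - HNAs_mul (HNAs_tw u) (HNAs_tw v)).
Proof. by exists 0%N; apply: ideal_gen; exists u, v. Qed.

Definition Fm := lquot Minf.
HB.instance Definition _ := GRing.Lmodule.on Fm.

Definition Fm_mul : {bilinear Fm -> Fm -> Fm} := qmul Minf_ideal.
Definition Fm_tw : {linear Fm -> Fm} := qmap Minf_tw.
Definition Fm_inj (x : V) : Fm := qpi Minf (HNAs_inj x).

Fact Fm_inj_is_linear : linear Fm_inj.
Proof. by move=> a x y; rewrite /Fm_inj linearP qpiP. Qed.
HB.instance Definition _ := GRing.isLinear.Build K V Fm *:%R Fm_inj
  Fm_inj_is_linear.

Lemma Fm_mulE u v : Fm_mul (qpi Minf u) (qpi Minf v) = qpi Minf (HNAs_mul u v).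
Proof. exact: qmul_qpi. Qed.

Lemma Fm_twE u : Fm_tw (qpi Minf u) = qpi Minf (HNAs_tw u).
Proof. exact: qmap_qpi. Qed.

Lemma Fm_twM (u v : Fm) : Fm_tw (Fm_mul u v) = Fm_mul (Fm_tw u) (Fm_tw v).
Proof.
have [x ->] := qpi_surj u; have [y ->] := qpi_surj v.
rewrite Fm_mulE !Fm_twE Fm_mulE; apply/qpi_eqP/Minf_gen.
Qed.

Lemma Fm_tw_inj x : Fm_tw (Fm_inj x) = Fm_inj (aV x).
Proof. by rewrite /Fm_inj Fm_twE HNAs_tw_inj. Qed.

Lemma Fm_ind (P : Fm -> Prop) :
    P 0 -> (forall a (u v : Fm), P u -> P v -> P (a *: u + v)) ->
    (forall x, P (Fm_inj x)) ->
    (forall u v : Fm, P u -> P v -> P (Fm_mul u v)) ->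
    (forall u : Fm, P u -> P (Fm_tw u)) ->
  forall u : Fm, P u.
Proof.
move=> P0 PL Pi PM PT u; have [{}u ->] := qpi_surj u.
elim/HNAs_ind: u => [|a u v Pu Pv|//|u v Pu Pv|u Pu].
- by rewrite linear0.
- by rewrite qpiP; apply: PL.
- by rewrite -Fm_mulE; apply: PM.
- by rewrite -Fm_twE; apply: PT.
Qed.

End FreeHomNonAssociative.

Section IdealMaps.
Variables (K : fieldType) (V : lmodType K) (mu : {bilinear V -> V -> V}).

Lemma ideal_morph (f : {linear V -> V}) (S T : V -> Prop) :
  (forall x y, f (mu x y) = mu (f x) (f y)) ->
  (forall x, S x -> ideal mu T (f x)) ->
  forall x, ideal mu S x -> ideal mu T (f x).
Proof.
move=> fM fS x; elim=> {x} [x /fS//||a x y _ Tx _ Ty|x y _ Ty|x y _ Tx].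
- by rewrite linear0; apply: ideal0.
- by rewrite linearP; apply: idealP.
- by rewrite fM; apply: idealMl.
- by rewrite fM; apply: idealMr.
Qed.

Lemma ideal_der (f D : {linear V -> V}) (S T : V -> Prop) :
  (forall x y, D (mu x y) = mu (D x) (f y) + mu (f x) (D y)) ->
  (forall x, ideal mu S x -> ideal mu T (f x)) ->
  (forall x, S x -> ideal mu T (D x)) ->
  forall x, ideal mu S x -> ideal mu T (D x).
Proof.
move=> DM fS DS x; elim=> {x} [x /DS//||a x y _ Tx _ Ty|x y Sy Ty|x y Sx Tx].
- by rewrite linear0; apply: ideal0.
- by rewrite linearP; apply: idealP.
- by rewrite DM; apply: subspaceD; apply: idealMl => //; apply: fS.
- by rewrite DM; apply: subspaceD; apply: idealMr => //; apply: fS.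
Qed.

End IdealMaps.

Section TwistedDerivation.
Variables (K : fieldType) (V : lmodType K) (mu : {bilinear V -> V -> V}).
Variables tw der : {linear V -> V}.
Hypothesis twM : forall u v, tw (mu u v) = mu (tw u) (tw v).
Hypothesis derC : forall u, der (tw u) = tw (der u).
Hypothesis derM : forall u v, der (mu u v) = mu (der u) (tw v) + mu (tw u) (der v).

Lemma der_associator u v w :
  der (mu (tw u) (mu v w) - mu (mu u v) (tw w)) =
      (mu (tw (der u)) (mu (tw v) (tw w)) - mu (mu (der u) (tw v)) (tw (tw w)))
    + (mu (tw (tw u)) (mu (der v) (tw w)) - mu (mu (tw u) (der v)) (tw (tw w)))
    + (mu (tw (tw u)) (mu (tw v) (der w)) - mu (mu (tw u) (tw v)) (tw (der w))).
Proof.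
rewrite linearB /= !derM !derC !twM linearDr linearDl /=.
by rewrite addrA !opprD [LHS]addrACA [X in X + _ = _]addrACA.
Qed.

Lemma der_commutator u v :
  der (mu u v - mu v u) =
    (mu (der u) (tw v) - mu (tw v) (der u))
    + (mu (tw u) (der v) - mu (der v) (tw u)).
Proof.
by rewrite linearB /= !derM [X in _ - X]addrC opprD addrACA.
Qed.

End TwistedDerivation.

Section FreeDerivation.
Variables (K : fieldType) (V : lmodType K) (aV dV : {linear V -> V}).

(* The only extension of d commuting with alpha_F and satisfying the twisted
   Leibniz rule for mu_F; it descends to the quotient by M_oo. *)
Fixpoint HNAs_der_pure t : (leaves t).-tuple V -> HNAs V :=
  match t with
  | Leaf => fun x => pure Leaf (map_tuple dV x)
  | Node k l r => fun x =>
      iter k (HNAs_tw aV)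
        (HNAs_mul (HNAs_der_pure (tleft x)) (HNAs_tw aV (pure r (tright x)))
         + HNAs_mul (HNAs_tw aV (pure l (tleft x))) (HNAs_der_pure (tright x)))
  end.

Definition HNAs_der : HNAs V -> HNAs V := tslift HNAs_der_pure.

Lemma HNAs_der_multilinear t : multilinear (@HNAs_der_pure t).
Proof.
elim: t => [|k l IHl r IHr] i a x x1 x2 H.
  exact: (@pure_multilinear _ _ _ leaves Leaf _ _ _ _ _ (lin_at_map dV H)).
have pl := @pure_multilinear K V _ leaves l.
have pr := @pure_multilinear K V _ leaves r.
rewrite /= in i x x1 x2 H *; elim: k {i H} (lin_at_split H) => [|k IHk] H /=; last first.
  by rewrite IHk // linearP.
case: H => [[j [H [e1 e2]]]|[j [H [e1 e2]]]]; rewrite e1 e2.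
  rewrite (IHl _ _ _ _ _ H) (pl _ _ _ _ _ H) linearP /=.
  by rewrite !linearDl !linearZl_LR /= scalerDr addrACA.
rewrite (IHr _ _ _ _ _ H) (pr _ _ _ _ _ H) linearP /=.
by rewrite !linearPr /= scalerDr addrACA.
Qed.

Fact HNAs_der_is_linear : linear HNAs_der.
Proof. by apply: tslift_linear; apply: HNAs_der_multilinear. Qed.
HB.instance Definition _ := GRing.isLinear.Build K (HNAs V) (HNAs V) *:%R
  HNAs_der HNAs_der_is_linear.

Lemma HNAs_der_pureE t x : HNAs_der (pure t x) = HNAs_der_pure x.
Proof. by apply: tslift_pure; apply: HNAs_der_multilinear. Qed.

Lemma HNAs_der_inj x : HNAs_der (HNAs_inj x) = HNAs_inj (dV x).
Proof. by rewrite HNAs_der_pureE; apply: eq_pure. Qed.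

Lemma HNAs_derM u v :
  HNAs_der (HNAs_mul u v) =
    HNAs_mul (HNAs_der u) (HNAs_tw aV v) + HNAs_mul (HNAs_tw aV u) (HNAs_der v).
Proof.
elim/tsum_ind: u => [|a s x u IHu]; first by rewrite !(linear0, linear0l) addr0.
rewrite !linearDl !linearZl_LR /= !linearP /= IHu !linearDl !linearZl_LR /=.
rewrite [RHS]addrACA -scalerDr; congr (_ *: _ + _) => {a u IHu}.
elim/tsum_ind: v => [|a t y v IHv]; first by rewrite !(linear0, linear0r) addr0.
rewrite !linearP !linearPr /= linearP /= IHv addrACA -scalerDr.
congr (_ *: _ + _) => {a v IHv}.
by rewrite HNAs_mulE !HNAs_der_pureE /= tleft_cat tright_cat.
Qed.

Hypothesis dC : forall x, dV (aV x) = aV (dV x).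

Lemma HNAs_derC u : HNAs_der (HNAs_tw aV u) = HNAs_tw aV (HNAs_der u).
Proof.
elim/tsum_ind: u => [|a t x u IHu]; first by rewrite !linear0.
rewrite !linearP /= IHu; congr (_ *: _ + _); rewrite HNAs_tw_pureE.
rewrite HNAs_der_pureE; case: t x => [|k l r] x; last by rewrite HNAs_der_pureE.
rewrite /= HNAs_der_pureE HNAs_tw_pureE /=; apply: eq_pure => //=.
by rewrite -!map_comp; apply: eq_map => y /=.
Qed.

Lemma HNAs_M_der n z : HNAs_M aV n z -> HNAs_M aV n.+1 (HNAs_der z).
Proof.
elim: n z => [|n IHn]; apply: (ideal_der HNAs_derM).
- exact: (@HNAs_M_tw K V aV 0%N).
- move=> _ [u [v ->]]; rewrite linearB /= HNAs_derC !HNAs_derM linearD /=.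
  rewrite !HNAs_derC opprD addrACA; apply: (@HNAs_MS K V aV 0%N);
    apply: subspaceD;
    by apply: ideal_gen; do 2!eexists.
- exact: (@HNAs_M_tw K V aV n.+1).
- move=> z [/IHn /HNAs_MS //|[y /IHn My ->]].
  by rewrite [_ (HNAs_tw _ _)]HNAs_derC; apply: (@HNAs_M_tw K V aV n.+1).
Qed.

Fact Minf_der : stable (Minf aV) HNAs_der.
Proof. by move=> z [n Mz]; exists n.+1; apply: HNAs_M_der. Qed.

End FreeDerivation.

Section FmDerivation.
Variables (K : fieldType) (V : lmodType K) (aV dV : {linear V -> V}).
Hypothesis dC : forall x, dV (aV x) = aV (dV x).

Definition Fm_der : {linear Fm aV -> Fm aV} := qmap (Minf_der dC).

Lemma Fm_derE u : Fm_der (qpi (Minf aV) u) = qpi (Minf aV) (HNAs_der aV dV u).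
Proof. exact: qmap_qpi. Qed.

Lemma Fm_der_inj x : Fm_der (Fm_inj aV x) = Fm_inj aV (dV x).
Proof. by rewrite /Fm_inj Fm_derE HNAs_der_inj. Qed.

Lemma Fm_derC u : Fm_der (Fm_tw aV u) = Fm_tw aV (Fm_der u).
Proof.
have [x ->] := qpi_surj u.
by rewrite Fm_twE !Fm_derE Fm_twE HNAs_derC.
Qed.

Lemma Fm_derM u v : Fm_der (Fm_mul aV u v) =
  Fm_mul aV (Fm_der u) (Fm_tw aV v) + Fm_mul aV (Fm_tw aV u) (Fm_der v).
Proof.
have [x ->] := qpi_surj u; have [y ->] := qpi_surj v.
by rewrite Fm_mulE !Fm_derE !Fm_twE !Fm_mulE HNAs_derM linearD.
Qed.

Lemma Fm_der_unique (D : {linear Fm aV -> Fm aV}) :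
    (forall x, D (Fm_inj aV x) = Fm_inj aV (dV x)) ->
    (forall u, D (Fm_tw aV u) = Fm_tw aV (D u)) ->
    (forall u v, D (Fm_mul aV u v) =
       Fm_mul aV (D u) (Fm_tw aV v) + Fm_mul aV (Fm_tw aV u) (D v)) ->
  D =1 Fm_der.
Proof.
move=> Di DC DM; elim/Fm_ind => [|a u v Du Dv|x|u v Du Dv|u Du].
- by rewrite !linear0.
- by rewrite !linearP /= Du Dv.
- by rewrite Di Fm_der_inj.
- by rewrite DM Fm_derM Du Dv.
- by rewrite DC Fm_derC Du.
Qed.

End FmDerivation.

Section FmMap.
Variables (K : fieldType) (V : lmodType K) (aV f : {linear V -> V}).

Definition HNAs_map : HNAs V -> HNAs V :=
  tslift (fun t x => pure t (map_tuple f x)).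

Lemma HNAs_map_multilinear t :
  multilinear (fun x : (leaves t).-tuple V => pure t (map_tuple f x)).
Proof. by move=> i a x x1 x2 /(lin_at_map f); apply: pure_multilinear. Qed.

Fact HNAs_map_is_linear : linear HNAs_map.
Proof. by apply: tslift_linear; apply: HNAs_map_multilinear. Qed.
HB.instance Definition _ := GRing.isLinear.Build K (HNAs V) (HNAs V) *:%R
  HNAs_map HNAs_map_is_linear.

Lemma HNAs_map_pure t x : HNAs_map (pure t x) = pure t (map_tuple f x).
Proof. by rewrite /HNAs_map tslift_pure //; apply: HNAs_map_multilinear. Qed.

Lemma HNAs_map_inj x : HNAs_map (HNAs_inj x) = HNAs_inj (f x).
Proof. by rewrite HNAs_map_pure; apply: eq_pure. Qed.

Lemma HNAs_mapM u v :
  HNAs_map (HNAs_mul u v) = HNAs_mul (HNAs_map u) (HNAs_map v).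
Proof.
elim/tsum_ind: u => [|a s x u IHu]; first by rewrite !(linear0, linear0l).
rewrite !linearDl !linearZl_LR /= !linearP /= IHu linearDl linearZl_LR /=.
congr (_ *: _ + _) => {a u IHu}.
elim/tsum_ind: v => [|a t y v IHv]; first by rewrite !(linear0, linear0r).
rewrite !linearP !linearPr /= linearP /= IHv; congr (_ *: _ + _) => {a v IHv}.
rewrite HNAs_mulE !HNAs_map_pure HNAs_mulE; apply: eq_pure => //=.
exact: map_cat.
Qed.

Hypothesis fC : forall x, f (aV x) = aV (f x).

Lemma HNAs_mapC u : HNAs_map (HNAs_tw aV u) = HNAs_tw aV (HNAs_map u).
Proof.
elim/tsum_ind: u => [|a t x u IHu]; first by rewrite !linear0.
rewrite !linearP /= IHu; congr (_ *: _ + _); rewrite HNAs_tw_pureE.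
rewrite HNAs_map_pure HNAs_tw_pureE; case: t x => [|k l r] x /=.
  rewrite HNAs_map_pure; apply: eq_pure => //=.
  by rewrite -!map_comp; apply: eq_map => y /=.
by rewrite HNAs_map_pure.
Qed.

Fact Minf_map : stable (Minf aV) HNAs_map.
Proof.
move=> z [n Mz]; exists n.
elim: n z Mz => [|n IHn]; apply: (ideal_morph HNAs_mapM).
  move=> _ [u [v ->]]; rewrite linearB /= HNAs_mapC !HNAs_mapM !HNAs_mapC.
  by apply: ideal_gen; do 2!eexists.
move=> z [/IHn|[y /IHn My ->]]; first exact: HNAs_MS.
by rewrite [_ (HNAs_tw _ _)]HNAs_mapC; apply: HNAs_M_tw.
Qed.

End FmMap.

Section FmMorphism.
Variables (K : fieldType) (V : lmodType K) (aV f : {linear V -> V}).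
Hypothesis fC : forall x, f (aV x) = aV (f x).

Definition Fm_map : {linear Fm aV -> Fm aV} := qmap (Minf_map fC).

Lemma Fm_mapE u : Fm_map (qpi (Minf aV) u) = qpi (Minf aV) (HNAs_map f u).
Proof. exact: qmap_qpi. Qed.

Lemma Fm_map_inj x : Fm_map (Fm_inj aV x) = Fm_inj aV (f x).
Proof. by rewrite /Fm_inj Fm_mapE HNAs_map_inj. Qed.

Lemma Fm_mapC u : Fm_map (Fm_tw aV u) = Fm_tw aV (Fm_map u).
Proof.
by have [x ->] := qpi_surj u; rewrite Fm_twE !Fm_mapE Fm_twE HNAs_mapC.
Qed.

Lemma Fm_mapM u v : Fm_map (Fm_mul aV u v) = Fm_mul aV (Fm_map u) (Fm_map v).
Proof.
have [x ->] := qpi_surj u; have [y ->] := qpi_surj v.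
by rewrite Fm_mulE !Fm_mapE Fm_mulE HNAs_mapM.
Qed.

Lemma Fm_mapK : cancel f aV -> cancel Fm_map (Fm_tw aV).
Proof.
move=> fK; elim/Fm_ind => [|a u v Hu Hv|x|u v Hu Hv|u Hu].
- by rewrite !linear0.
- by rewrite !linearP /= Hu Hv.
- by rewrite Fm_map_inj Fm_tw_inj fK.
- by rewrite Fm_mapM Fm_twM Hu Hv.
- by rewrite Fm_mapC Hu.
Qed.

End FmMorphism.

Section Inverse.
Variables (A B : Type) (f : A -> B).

Fact bij_inv_subproof : bijective f -> exists g, cancel f g /\ cancel g f.
Proof. by case=> g fK gK; exists g. Qed.

Definition bij_inv (bf : bijective f) : B -> A :=
  projT1 (cid (bij_inv_subproof bf)).

Variable bf : bijective f.

Lemma bij_invK : cancel f (bij_inv bf).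
Proof. by rewrite /bij_inv; case: cid => g []. Qed.

Lemma bij_invKV : cancel (bij_inv bf) f.
Proof. by rewrite /bij_inv; case: cid => g []. Qed.

End Inverse.

Section LinearInverse.
Variables (K : fieldType) (U V : lmodType K) (f : {linear U -> V}).
Variable bf : bijective f.

Fact bij_inv_is_linear : linear (bij_inv bf).
Proof.
by move=> a x y; apply: (bij_inj bf); rewrite linearP /= !bij_invKV.
Qed.
HB.instance Definition _ := GRing.isLinear.Build K V U *:%R (bij_inv bf)
  bij_inv_is_linear.

End LinearInverse.

Record homLieDer (K : fieldType) := HomLieDer {
  hl_car :> lmodType K;
  hl_br : {bilinear hl_car -> hl_car -> hl_car};
  hl_tw : {linear hl_car -> hl_car};
  hl_der : {linear hl_car -> hl_car};
  hl_skew : forall x y, hl_br x y = - hl_br y x;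
  hl_jacobi : forall x y z,
    hl_br (hl_tw x) (hl_br y z) + hl_br (hl_tw y) (hl_br z x)
      + hl_br (hl_tw z) (hl_br x y) = 0;
  hl_twM : forall x y, hl_tw (hl_br x y) = hl_br (hl_tw x) (hl_tw y);
  hl_derC : forall x, hl_der (hl_tw x) = hl_tw (hl_der x);
  hl_derM : forall x y,
    hl_der (hl_br x y) = hl_br (hl_der x) (hl_tw y) + hl_br (hl_tw x) (hl_der y)
}.

Record homAsDer (K : fieldType) := HomAsDer {
  ha_car :> lmodType K;
  ha_mul : {bilinear ha_car -> ha_car -> ha_car};
  ha_tw : {linear ha_car -> ha_car};
  ha_der : {linear ha_car -> ha_car};
  ha_twM : forall a b, ha_tw (ha_mul a b) = ha_mul (ha_tw a) (ha_tw b);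
  ha_assoc : forall a b c,
    ha_mul (ha_tw a) (ha_mul b c) = ha_mul (ha_mul a b) (ha_tw c);
  ha_derC : forall a, ha_der (ha_tw a) = ha_tw (ha_der a);
  ha_derM : forall a b,
    ha_der (ha_mul a b) = ha_mul (ha_der a) (ha_tw b) + ha_mul (ha_tw a) (ha_der b)
}.

Record lieDer (K : fieldType) := LieDer {
  li_car :> lmodType K;
  li_br : {bilinear li_car -> li_car -> li_car};
  li_der : {linear li_car -> li_car};
  li_skew : forall x y, li_br x y = - li_br y x;
  li_jacobi : forall x y z,
    li_br x (li_br y z) + li_br y (li_br z x) + li_br z (li_br x y) = 0;
  li_derM : forall x y,
    li_der (li_br x y) = li_br (li_der x) y + li_br x (li_der y)
}.

(* No unit is required. *)
Record asDer (K : fieldType) := AsDer {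
  as_car :> lmodType K;
  as_mul : {bilinear as_car -> as_car -> as_car};
  as_der : {linear as_car -> as_car};
  as_assoc : forall a b c, as_mul a (as_mul b c) = as_mul (as_mul a b) c;
  as_derM : forall a b,
    as_der (as_mul a b) = as_mul (as_der a) b + as_mul a (as_der b)
}.

Arguments hl_br {K _}.
Arguments hl_tw {K _}.
Arguments hl_der {K _}.
Arguments ha_mul {K _}.
Arguments ha_tw {K _}.
Arguments ha_der {K _}.
Arguments li_br {K _}.
Arguments li_der {K _}.
Arguments as_mul {K _}.
Arguments as_der {K _}.

Section Morphisms.
Variable K : fieldType.

Definition homAsDer_morph (A B : homAsDer K) (f : A -> B) :=
  [/\ linear f,
      forall a b, f (ha_mul a b) = ha_mul (f a) (f b),
      forall a, f (ha_tw a) = ha_tw (f a)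
    & forall a, f (ha_der a) = ha_der (f a)].

Definition homAsDer_iso (A B : homAsDer K) (f : A -> B) :=
  homAsDer_morph f /\
  exists g : B -> A, [/\ homAsDer_morph g, cancel f g & cancel g f].

Definition asDer_morph (A B : asDer K) (f : A -> B) :=
  [/\ linear f,
      forall a b, f (as_mul a b) = as_mul (f a) (f b)
    & forall a, f (as_der a) = as_der (f a)].

Definition asDer_iso (A B : asDer K) (f : A -> B) :=
  asDer_morph f /\
  exists g : B -> A, [/\ asDer_morph g, cancel f g & cancel g f].

End Morphisms.

Section YauTwist.
Variables (K : fieldType) (A : asDer K) (f : {linear A -> A}).
Hypothesis fM : forall a b, f (as_mul a b) = as_mul (f a) (f b).
Hypothesis fC : forall a, as_der (f a) = f (as_der a).

Definition twist_mul (a b : A) : A := f (as_mul a b).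

Fact twist_mul_is_bilinear : bilinear_for *:%R *:%R twist_mul.
Proof.
split=> w a u v; rewrite /twist_mul; last by rewrite linearPr linearP.
by rewrite linearDl linearZl_LR linearP.
Qed.
HB.instance Definition _ := bilinear_isBilinear.Build K A A A *:%R *:%R
  twist_mul twist_mul_is_bilinear.

Definition twist_der (a : A) : A := f (as_der a).

Fact twist_der_is_linear : linear twist_der.
Proof. by move=> a x y; rewrite /twist_der !linearP. Qed.
HB.instance Definition _ := GRing.isLinear.Build K A A *:%R
  twist_der twist_der_is_linear.

Fact twist_twM a b : f (twist_mul a b) = twist_mul (f a) (f b).
Proof. by rewrite /twist_mul fM. Qed.

Fact twist_assoc a b c :
  twist_mul (f a) (twist_mul b c) = twist_mul (twist_mul a b) (f c).
Proof. by rewrite /twist_mul -!fM as_assoc. Qed.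

Fact twist_derC a : twist_der (f a) = f (twist_der a).
Proof. by rewrite /twist_der fC. Qed.

Fact twist_derM a b : twist_der (twist_mul a b) =
  twist_mul (twist_der a) (f b) + twist_mul (f a) (twist_der b).
Proof. by rewrite /twist_der /twist_mul fC as_derM !linearD /= !fM. Qed.

Definition yau_twist : homAsDer K :=
  @HomAsDer K A twist_mul f twist_der twist_twM twist_assoc twist_derC twist_derM.

End YauTwist.

Section Untwist.
Variables (K : fieldType) (A : homAsDer K) (bA : bijective (@ha_tw K A)).

Definition untwist_mul (a b : A) : A := bij_inv bA (ha_mul a b).

Fact untwist_mul_is_bilinear : bilinear_for *:%R *:%R untwist_mul.
Proof.
split=> w a u v; rewrite /untwist_mul; last by rewrite linearPr linearP.
by rewrite linearDl linearZl_LR linearP.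
Qed.
HB.instance Definition _ := bilinear_isBilinear.Build K A A A *:%R *:%R
  untwist_mul untwist_mul_is_bilinear.

Definition untwist_der (a : A) : A := bij_inv bA (ha_der a).

Fact untwist_der_is_linear : linear untwist_der.
Proof. by move=> a x y; rewrite /untwist_der !linearP. Qed.
HB.instance Definition _ := GRing.isLinear.Build K A A *:%R
  untwist_der untwist_der_is_linear.

Fact untwist_assoc a b c :
  untwist_mul a (untwist_mul b c) = untwist_mul (untwist_mul a b) c.
Proof.
apply: (bij_inj bA); rewrite !bij_invKV; apply: (bij_inj bA).
by rewrite !ha_twM !bij_invKV ha_assoc.
Qed.

Fact untwist_derM a b : untwist_der (untwist_mul a b) =
  untwist_mul (untwist_der a) b + untwist_mul a (untwist_der b).
Proof.
apply: (bij_inj bA); rewrite linearD /= !bij_invKV; apply: (bij_inj bA).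
by rewrite linearD /= !ha_twM -ha_derC !bij_invKV ha_derM.
Qed.

Definition untwist : asDer K :=
  @AsDer K A untwist_mul untwist_der untwist_assoc untwist_derM.

End Untwist.

Section Um.
Variables (K : fieldType) (g : homLieDer K).

Local Notation F := (Fm (@hl_tw K g)).
Local Notation tw := (Fm_tw (@hl_tw K g)).
Local Notation mul := (Fm_mul (@hl_tw K g)).
Local Notation j := (Fm_inj (@hl_tw K g)).
Local Notation der := (Fm_der (@hl_derC K g)).

Definition Um_gen (z : F) :=
  (exists u v w, z = mul (tw u) (mul v w) - mul (mul u v) (tw w)) \/
  (exists x y : g, z = j (hl_br x y) - (mul (j x) (j y) - mul (j y) (j x))).

Definition Um_ideal := ideal mul Um_gen.

Lemma Um_gen_assoc u v w :
  Um_ideal (mul (tw u) (mul v w) - mul (mul u v) (tw w)).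
Proof. by apply: ideal_gen; left; exists u, v, w. Qed.

Lemma Um_gen_br x y :
  Um_ideal (j (hl_br x y) - (mul (j x) (j y) - mul (j y) (j x))).
Proof. by apply: ideal_gen; right; exists x, y. Qed.

Fact Um_tw_stable : stable Um_ideal tw.
Proof.
apply: (ideal_morph (Fm_twM (aV := @hl_tw K g))).
move=> _ [[u [v [w ->]]]|[x [y ->]]].
  by rewrite linearB /= !Fm_twM; apply: Um_gen_assoc.
by rewrite linearB /= [X in _ - X]linearB /= !Fm_twM !Fm_tw_inj hl_twM; apply: Um_gen_br.
Qed.

Fact Um_der_stable : stable Um_ideal der.
Proof.
apply: (ideal_der (Fm_derM (@hl_derC K g)) Um_tw_stable).
move=> _ [[u [v [w ->]]]|[x [y ->]]].
  rewrite (der_associator (Fm_twM (aV := @hl_tw K g)) (Fm_derC (@hl_derC K g))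
    (Fm_derM (@hl_derC K g))).
  by apply: subspaceD; [apply: subspaceD|]; apply: Um_gen_assoc.
rewrite linearB /= (der_commutator (Fm_derM (@hl_derC K g))) !Fm_der_inj.
rewrite !Fm_tw_inj hl_derM linearD opprD addrACA.
by apply: (@subspaceD _ _ Um_ideal); apply: Um_gen_br.
Qed.

Definition Um_car := lquot Um_ideal.
HB.instance Definition _ := GRing.Lmodule.on Um_car.

Definition Um_mul : {bilinear Um_car -> Um_car -> Um_car} :=
  qmul (@ideal_is_ideal K F mul Um_gen).
Definition Um_tw : {linear Um_car -> Um_car} := qmap Um_tw_stable.
Definition Um_der : {linear Um_car -> Um_car} := qmap Um_der_stable.

Local Notation pi := (qpi Um_ideal).

Lemma Um_mulE u v : Um_mul (pi u) (pi v) = pi (mul u v).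
Proof. exact: qmul_qpi. Qed.
Lemma Um_twE u : Um_tw (pi u) = pi (tw u). Proof. exact: qmap_qpi. Qed.
Lemma Um_derE u : Um_der (pi u) = pi (der u). Proof. exact: qmap_qpi. Qed.

Fact Um_twM u v : Um_tw (Um_mul u v) = Um_mul (Um_tw u) (Um_tw v).
Proof.
have [x ->] := qpi_surj u; have [y ->] := qpi_surj v.
by rewrite (Um_mulE x y) !Um_twE Um_mulE Fm_twM.
Qed.

Fact Um_assoc u v w : Um_mul (Um_tw u) (Um_mul v w) = Um_mul (Um_mul u v) (Um_tw w).
Proof.
have [x ->] := qpi_surj u; have [y ->] := qpi_surj v; have [z ->] := qpi_surj w.
by rewrite !Um_twE !Um_mulE; apply/qpi_eqP/Um_gen_assoc.
Qed.

Fact Um_derC u : Um_der (Um_tw u) = Um_tw (Um_der u).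
Proof.
have [x ->] := qpi_surj u.
by rewrite Um_twE !Um_derE Um_twE Fm_derC.
Qed.

Fact Um_derM u v :
  Um_der (Um_mul u v) = Um_mul (Um_der u) (Um_tw v) + Um_mul (Um_tw u) (Um_der v).
Proof.
have [x ->] := qpi_surj u; have [y ->] := qpi_surj v.
by rewrite (Um_mulE x y) !Um_twE !Um_derE !Um_mulE Fm_derM qpiD.
Qed.

Definition Um : homAsDer K :=
  @HomAsDer K Um_car Um_mul Um_tw Um_der Um_twM Um_assoc Um_derC Um_derM.

Definition iotaU (x : g) : Um := pi (j x).

Section Bijective.
Hypothesis bg : bijective (@hl_tw K g).

Let f : {linear g -> g} := bij_inv bg.

Let fC x : f (hl_tw x) = hl_tw (f x).
Proof. by rewrite /f /= bij_invK bij_invKV. Qed.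

Lemma bij_inv_br x y :
  bij_inv bg (hl_br x y) = hl_br (bij_inv bg x) (bij_inv bg y).
Proof. by apply: (bij_inj bg); rewrite hl_twM !bij_invKV. Qed.

Fact Um_map_stable : stable Um_ideal (Fm_map fC).
Proof.
apply: (ideal_morph (Fm_mapM fC)) => _ [[u [v [w ->]]]|[x [y ->]]].
  by rewrite linearB /= !Fm_mapM !Fm_mapC; apply: Um_gen_assoc.
by rewrite linearB /= [X in _ - X]linearB /= !Fm_mapM !Fm_map_inj /f /= bij_inv_br; apply: Um_gen_br.
Qed.

Fact Um_tw_bij : bijective (@ha_tw K Um).
Proof.
have fK : cancel f (@hl_tw K g) by apply: bij_invKV.
exists (qmap Um_map_stable) => u; have [x ->] := qpi_surj u.
  by rewrite /= Um_twE qmap_qpi Fm_mapC (Fm_mapK fC fK).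
by rewrite /= qmap_qpi Um_twE (Fm_mapK fC fK).
Qed.

End Bijective.
End Um.

(* T^+(V); the summand of index n is V^{(x) n+1}. *)
Section TensorAlgebra.
Variables (K : fieldType) (V : lmodType K).

Definition Tp := @tsum K V nat S.
HB.instance Definition _ := GRing.Lmodule.on Tp.

Definition Tp_inj (x : V) : Tp := @pure K V nat S 0%N [tuple x].

Fact Tp_inj_is_linear : linear Tp_inj.
Proof.
move=> a x y; apply: (@pure_multilinear K V nat S 0%N ord0).
by split=> // j; rewrite [j]ord1.
Qed.
HB.instance Definition _ := GRing.isLinear.Build K V Tp *:%R Tp_inj
  Tp_inj_is_linear.

Definition Tp_mul_pure m (x : m.+1.-tuple V) n (y : n.+1.-tuple V) : Tp :=
  @pure K V nat S (m + n.+1)%N (cat_tuple x y).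

Definition Tp_mul (u v : Tp) : Tp :=
  tslift (fun m x => tslift (fun n y => Tp_mul_pure x y) v) u.

Lemma Tp_mul_multilinear m x : forall n, multilinear (@Tp_mul_pure m x n).
Proof.
move=> n i a y y1 y2 H.
exact: (@pure_multilinear K V nat S (m + n.+1)%N _ _ _ _ _
  (@lin_at_catr K V m.+1 n.+1 i a y y1 y2 x H)).
Qed.

Lemma Tp_mul_multilinearl v m :
  multilinear (fun x => tslift (fun n y => @Tp_mul_pure m x n y) v).
Proof.
move=> i a x x1 x2 H; apply: tslift_comb => n y.
exact: (@pure_multilinear K V nat S (m + n.+1)%N _ _ _ _ _
  (@lin_at_catl K V m.+1 n.+1 i a x x1 x2 y H)).
Qed.

Lemma Tp_mulE m x n y :
  Tp_mul (@pure K V nat S m x) (@pure K V nat S n y) = Tp_mul_pure x y.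
Proof.
rewrite /Tp_mul tslift_pure; last exact: Tp_mul_multilinearl.
by rewrite tslift_pure //; apply: Tp_mul_multilinear.
Qed.

Fact Tp_mul_is_bilinear : bilinear_for *:%R *:%R Tp_mul.
Proof.
split=> w a u v; rewrite /Tp_mul.
  by apply: tslift_linear => m; apply: Tp_mul_multilinearl.
apply: tslift_comb => m x; apply: tslift_linear => n.
exact: Tp_mul_multilinear.
Qed.
HB.instance Definition _ := bilinear_isBilinear.Build K Tp Tp Tp
  *:%R *:%R Tp_mul Tp_mul_is_bilinear.

Lemma Tp_mulA u v w : Tp_mul u (Tp_mul v w) = Tp_mul (Tp_mul u v) w.
Proof.
elim/tsum_ind: u => [|a m x u IHu]; first by rewrite !linear0l.
rewrite !(linearDl, linearZl_LR) /= IHu; congr (_ *: _ + _) => {a u IHu}.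
elim/tsum_ind: v => [|a n y v IHv]; first by rewrite !(linear0l, linear0r).
rewrite !(linearDl, linearZl_LR) /= !linearPr /= !(linearDl, linearZl_LR) /= IHv.
congr (_ *: _ + _) => {a v IHv}.
elim/tsum_ind: w => [|a p z w IHw]; first by rewrite !linear0r.
rewrite !linearPr /= IHw; congr (_ *: _ + _) => {a w IHw}.
rewrite !Tp_mulE; apply: eq_pure.
  by rewrite -addnA addSn.
by rewrite /= catA.
Qed.

Lemma Tp_ind (P : Tp -> Prop) :
    P 0 -> (forall a u v, P u -> P v -> P (a *: u + v)) ->
    (forall x, P (Tp_inj x)) ->
    (forall u v, P u -> P v -> P (Tp_mul u v)) ->
  forall u, P u.
Proof.
move=> P0 PL Pi PM; apply: tsum_ind => // a n x z Pz; apply: PL => // {a z Pz}.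
elim: n x => [|n IHn] x; case/tupleP: x => y x.
  rewrite [x]tuple0; have -> : @pure K V nat S 0%N [tuple of y :: [tuple]] = Tp_inj y.
    exact: eq_pure.
  exact: Pi.
have -> : @pure K V nat S n.+1 [tuple of y :: x] =
    Tp_mul (Tp_inj y) (@pure K V nat S n x).
  by rewrite /Tp_inj Tp_mulE; apply: eq_pure.
exact: PM.
Qed.

Section Map.
Variable f : {linear V -> V}.

Definition Tp_map : Tp -> Tp :=
  tslift (fun n (x : n.+1.-tuple V) => @pure K V nat S n (map_tuple f x)).

Lemma Tp_map_multilinear n :
  multilinear (fun x : n.+1.-tuple V => @pure K V nat S n (map_tuple f x)).
Proof.
move=> i a x x1 x2 /(lin_at_map f).
exact: (@pure_multilinear K V nat S n).
Qed.

Fact Tp_map_is_linear : linear Tp_map.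
Proof. by apply: tslift_linear; apply: Tp_map_multilinear. Qed.
HB.instance Definition _ := GRing.isLinear.Build K Tp Tp *:%R Tp_map
  Tp_map_is_linear.

Lemma Tp_map_pure n x :
  Tp_map (@pure K V nat S n x) = @pure K V nat S n (map_tuple f x).
Proof. by rewrite /Tp_map tslift_pure //; apply: Tp_map_multilinear. Qed.

Lemma Tp_map_inj x : Tp_map (Tp_inj x) = Tp_inj (f x).
Proof. by rewrite Tp_map_pure; apply: eq_pure. Qed.

Lemma Tp_mapM u v : Tp_map (Tp_mul u v) = Tp_mul (Tp_map u) (Tp_map v).
Proof.
elim/tsum_ind: u => [|a m x u IHu]; first by rewrite !(linear0, linear0l).
rewrite !linearDl !linearZl_LR /= !linearP /= IHu linearDl linearZl_LR /=.
congr (_ *: _ + _) => {a u IHu}.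
elim/tsum_ind: v => [|a n y v IHv]; first by rewrite !(linear0, linear0r).
rewrite !linearP !linearPr /= linearP /= IHv; congr (_ *: _ + _) => {a v IHv}.
rewrite Tp_mulE !Tp_map_pure Tp_mulE; apply: eq_pure => //=.
exact: map_cat.
Qed.
End Map.

Section Der.
Variable d : {linear V -> V}.

Definition der_at n (i : 'I_n) (x : n.-tuple V) : n.-tuple V :=
  [tuple if j == i then d (tnth x j) else tnth x j | j < n].

Definition Tp_der_pure n (x : n.+1.-tuple V) : Tp :=
  \sum_(i < n.+1) @pure K V nat S n (der_at i x).

Definition Tp_der : Tp -> Tp := tslift Tp_der_pure.

Lemma lin_at_der n (k : 'I_n) i a (x x1 x2 : n.-tuple V) :
  lin_at i a x x1 x2 -> lin_at i a (der_at k x) (der_at k x1) (der_at k x2).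
Proof.
case=> Hi Hj; split=> [|j /Hj [e1 e2]]; rewrite !tnth_mktuple.
  by rewrite Hi; case: eqP => // _; rewrite linearP.
by rewrite e1 e2.
Qed.

Lemma Tp_der_multilinear n : multilinear (@Tp_der_pure n).
Proof.
move=> i a x x1 x2 H; rewrite /Tp_der_pure scaler_sumr -big_split /=.
apply: eq_bigr => k _; apply: (@pure_multilinear K V nat S n).
exact: lin_at_der H.
Qed.

Fact Tp_der_is_linear : linear Tp_der.
Proof. by apply: tslift_linear; apply: Tp_der_multilinear. Qed.
HB.instance Definition _ := GRing.isLinear.Build K Tp Tp *:%R Tp_der
  Tp_der_is_linear.

Lemma Tp_der_pureE n x : Tp_der (@pure K V nat S n x) = Tp_der_pure x.
Proof. by apply: tslift_pure; apply: Tp_der_multilinear. Qed.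

Lemma Tp_der_inj x : Tp_der (Tp_inj x) = Tp_inj (d x).
Proof.
rewrite Tp_der_pureE /Tp_der_pure big_ord1; congr pure.
by apply: eq_from_tnth => i; rewrite tnth_mktuple [i]ord1.
Qed.

Lemma der_at_catl m n (i : 'I_m) (x : m.-tuple V) (y : n.-tuple V) :
  der_at (lshift n i) (cat_tuple x y) = cat_tuple (der_at i x) y.
Proof.
apply: eq_from_tnth => j; rewrite tnth_mktuple; case: (split_ordP j) => k ->.
  by rewrite !tnth_lshift tnth_mktuple eq_lshift.
by rewrite !tnth_rshift eq_rlshift.
Qed.

Lemma der_at_catr m n (i : 'I_n) (x : m.-tuple V) (y : n.-tuple V) :
  der_at (rshift m i) (cat_tuple x y) = cat_tuple x (der_at i y).
Proof.
apply: eq_from_tnth => j; rewrite tnth_mktuple; case: (split_ordP j) => k ->.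
  by rewrite !tnth_lshift eq_lrshift.
by rewrite !tnth_rshift tnth_mktuple eq_rshift.
Qed.

Lemma Tp_derM u v :
  Tp_der (Tp_mul u v) = Tp_mul (Tp_der u) v + Tp_mul u (Tp_der v).
Proof.
elim/tsum_ind: u => [|a m x u IHu]; first by rewrite !(linear0, linear0l) addr0.
rewrite !linearDl !linearZl_LR /= !linearP /= IHu !linearDl !linearZl_LR /=.
rewrite [RHS]addrACA -scalerDr; congr (_ *: _ + _) => {a u IHu}.
elim/tsum_ind: v => [|a n y v IHv]; first by rewrite !(linear0, linear0r) addr0.
rewrite !linearP !linearPr /= linearP /= IHv addrACA -scalerDr.
congr (_ *: _ + _) => {a v IHv}.
rewrite Tp_mulE !Tp_der_pureE /Tp_der_pure linear_sumlz linear_sumr.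
rewrite [LHS](@big_split_ord Tp 0 +%R m.+1 n.+1) /=.
by congr (_ + _); apply: eq_bigr => i _; rewrite Tp_mulE /Tp_mul_pure;
  rewrite -(der_at_catl, der_at_catr).
Qed.
End Der.

End TensorAlgebra.

Section Uplus.
Variables (K : fieldType) (L : lieDer K).

Local Notation mul := (@Tp_mul K L).
Local Notation j := (@Tp_inj K L).

Definition Up_gen (z : Tp L) :=
  exists x y : L, z = mul (j x) (j y) - mul (j y) (j x) - j (li_br x y).

Definition Up_ideal := ideal mul Up_gen.

Lemma Up_gen_br x y :
  Up_ideal (mul (j x) (j y) - mul (j y) (j x) - j (li_br x y)).
Proof. by apply: ideal_gen; exists x, y. Qed.

Fact Up_der_stable : stable Up_ideal (Tp_der li_der).
Proof.
apply: (@ideal_der _ _ _ (@idfun (Tp L) : {linear Tp L -> Tp L})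
  (Tp_der li_der) _ _ (Tp_derM li_der)) => // _ [x [y ->]].
rewrite linearB /=.
rewrite (@der_commutator _ _ _ (@idfun (Tp L) : {linear Tp L -> Tp L})
  (Tp_der li_der) (Tp_derM li_der)) /= !Tp_der_inj.
rewrite li_derM linearD opprD addrACA.
by apply: (@subspaceD _ _ Up_ideal); apply: Up_gen_br.
Qed.

Definition Up_car := lquot Up_ideal.
HB.instance Definition _ := GRing.Lmodule.on Up_car.

Definition Up_mul : {bilinear Up_car -> Up_car -> Up_car} :=
  qmul (@ideal_is_ideal K (Tp L) mul Up_gen).
Definition Up_der : {linear Up_car -> Up_car} := qmap Up_der_stable.

Local Notation pi := (qpi Up_ideal).

Lemma Up_mulE u v : Up_mul (pi u) (pi v) = pi (mul u v).
Proof. exact: qmul_qpi. Qed.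
Lemma Up_derE u : Up_der (pi u) = pi (Tp_der li_der u).
Proof. exact: qmap_qpi. Qed.

Fact Up_assoc u v w : Up_mul u (Up_mul v w) = Up_mul (Up_mul u v) w.
Proof.
have [x ->] := qpi_surj u; have [y ->] := qpi_surj v; have [z ->] := qpi_surj w.
by rewrite (Up_mulE y z) (Up_mulE x y) !Up_mulE Tp_mulA.
Qed.

Fact Up_derM u v :
  Up_der (Up_mul u v) = Up_mul (Up_der u) v + Up_mul u (Up_der v).
Proof.
have [x ->] := qpi_surj u; have [y ->] := qpi_surj v.
by rewrite (Up_mulE x y) !Up_derE !Up_mulE Tp_derM qpiD.
Qed.

Definition Up : asDer K := @AsDer K Up_car Up_mul Up_der Up_assoc Up_derM.

Definition iota0 (x : L) : Up := pi (j x).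

Lemma Up_der_iota x : as_der (iota0 x) = iota0 (li_der x).
Proof. by rewrite /iota0 /= Up_derE Tp_der_inj. Qed.

Section Map.
Variable f : {linear L -> L}.
Hypothesis fM : forall x y, f (li_br x y) = li_br (f x) (f y).

Fact Up_map_stable : stable Up_ideal (Tp_map f).
Proof.
apply: (ideal_morph (Tp_mapM f)) => _ [x [y ->]].
rewrite linearB /= linearB /= !Tp_mapM !Tp_map_inj fM.
exact: Up_gen_br.
Qed.

Definition Up_map : {linear Up -> Up} := qmap Up_map_stable.

Lemma Up_mapE u : Up_map (pi u) = pi (Tp_map f u).
Proof. exact: qmap_qpi. Qed.

Lemma Up_map_iota x : Up_map (iota0 x) = iota0 (f x).
Proof. by rewrite /iota0 Up_mapE Tp_map_inj. Qed.

Fact Up_mapM u v : Up_map (as_mul u v) = as_mul (Up_map u) (Up_map v).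
Proof.
rewrite /=; have [x ->] := qpi_surj u; have [y ->] := qpi_surj v.
by rewrite (Up_mulE x y) !Up_mapE Up_mulE Tp_mapM.
Qed.

Hypothesis fC : forall x, li_der (f x) = f (li_der x).

Fact Up_mapC u : as_der (Up_map u) = Up_map (as_der u).
Proof.
rewrite /=; have [{}u ->] := qpi_surj u.
rewrite (Up_derE u) !Up_mapE Up_derE; congr qpi.
elim/Tp_ind: u => [|a u v Hu Hv|x|u v Hu Hv].
- by rewrite !linear0.
- by rewrite !linearP /= Hu Hv.
- by rewrite !(Tp_map_inj, Tp_der_inj) fC.
- by rewrite !(Tp_mapM, Tp_derM) linearD /= !Tp_mapM Hu Hv.
Qed.
End Map.

End Uplus.

Section G0.
Variables (K : fieldType) (g : homLieDer K) (bg : bijective (@hl_tw K g)).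

Definition g0_br (x y : g) : g := bij_inv bg (hl_br x y).

Fact g0_br_is_bilinear : bilinear_for *:%R *:%R g0_br.
Proof.
split=> w a u v; rewrite /g0_br; last by rewrite linearPr linearP.
by rewrite linearDl linearZl_LR linearP.
Qed.
HB.instance Definition _ := bilinear_isBilinear.Build K g g g *:%R *:%R
  g0_br g0_br_is_bilinear.

Definition g0_der (x : g) : g := bij_inv bg (hl_der x).

Fact g0_der_is_linear : linear g0_der.
Proof. by move=> a x y; rewrite /g0_der !linearP. Qed.
HB.instance Definition _ := GRing.isLinear.Build K g g *:%R
  g0_der g0_der_is_linear.

Fact g0_skew x y : g0_br x y = - g0_br y x.
Proof. by rewrite /g0_br hl_skew linearN. Qed.

Fact g0_jacobi x y z :
  g0_br x (g0_br y z) + g0_br y (g0_br z x) + g0_br z (g0_br x y) = 0.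
Proof.
apply: (bij_inj bg); rewrite !linearD /= linear0 !bij_invKV.
apply: (bij_inj bg); rewrite !linearD /= linear0 !hl_twM !bij_invKV.
exact: hl_jacobi.
Qed.

Fact g0_derM x y : g0_der (g0_br x y) = g0_br (g0_der x) y + g0_br x (g0_der y).
Proof.
apply: (bij_inj bg); rewrite linearD /= !bij_invKV.
apply: (bij_inj bg); rewrite linearD /= !hl_twM -hl_derC !bij_invKV.
exact: hl_derM.
Qed.

Definition g0 : lieDer K :=
  @LieDer K g g0_br g0_der g0_skew g0_jacobi g0_derM.

Fact g0_twM (x y : g0) : hl_tw (li_br x y) = li_br (hl_tw x : g0) (hl_tw y).
Proof. by apply: (bij_inj bg); rewrite /= /g0_br !bij_invKV hl_twM. Qed.

Fact g0_twC (x : g0) : li_der (hl_tw x : g0) = hl_tw (li_der x).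
Proof. by apply: (bij_inj bg); rewrite /= /g0_der !bij_invKV hl_derC. Qed.

Definition Uplus_twisted : homAsDer K :=
  yau_twist (@Up_mapM K g0 hl_tw g0_twM) (@Up_mapC K g0 hl_tw g0_twM g0_twC).

End G0.

(* Main.v *)
(* Each side has a universal property, and the two properties match.  iota0 sends
   [x, y] to the commutator of iota0 x and iota0 y for the twisted product
   a ._alpha b, which yields Phi : Um g -> Uplus_twisted; since
   [x, y]_0 = alpha^-1 [x, y], iotaU sends [x, y]_0 to the commutator of iotaU x
   and iotaU y for the untwisted product u * v of Um g, which yields Psi in the
   other direction.  Twisting and untwisting turn Phi and Psi into morphisms for
   either kind of structure, and generators determine morphisms, hence Phi and
   Psi are mutually inverse. *)
Require Import Defs.
From HB Require Import structures.
From mathcomp Require Import all_boot all_algebra.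
From mathcomp Require Import boolp.

Set Implicit Arguments.
Unset Strict Implicit.
Unset Printing Implicit Defensive.

Import GRing.Theory.

Local Open Scope ring_scope.

(** * Linear maps vanishing on generated ideals *)

Lemma linear_fun0 (K : fieldType) (V W : lmodType K) (f : V -> W) :
  linear f -> f 0 = 0.
Proof. by move=> fL; have := fL (-1) 0 0; rewrite scaler0 addr0 scaleN1r addNr. Qed.

(** The kernel of a multiplicative linear map is a two-sided ideal. Every factorization through a
    quotient below rests on this. *)
Lemma ideal_ker (K : fieldType) (V W : lmodType K)
    (mu : {bilinear V -> V -> V}) (nu : {bilinear W -> W -> W})
    (f : V -> W) (S : V -> Prop) :
  linear f ->
  (forall x y, f (mu x y) = nu (f x) (f y)) ->
  (forall x, S x -> f x = 0) ->
  forall x, ideal mu S x -> f x = 0.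
Proof.
move=> fL fM fS x; elim=> {x} [x /fS//||a x y _ fx _ fy|x y _ fy|x y _ fx].
- exact: linear_fun0.
- by rewrite fL fx fy scaler0 addr0.
- by rewrite fM fy linear0r.
- by rewrite fM fx linear0l.
Qed.

(** * Universal property of the free Hom-nonassociative algebra *)

Section FmLift.
Variables (K : fieldType) (V : lmodType K) (aV : {linear V -> V}).
Variables (W : lmodType K) (mu : {bilinear W -> W -> W}) (tw : {linear W -> W}).
Variable f : {linear V -> W}.

(** A vertex of weight [k] is the [k]-fold twist of a product, so these values are forced on any
    extension of [f] compatible with products and twists. *)
Fixpoint HNAs_lift_pure t : (leaves t).-tuple V -> W :=
  match t with
  | Leaf => fun x => f (thead x)
  | Node k l r => fun x =>
      iter k tw (mu (HNAs_lift_pure (tleft x)) (HNAs_lift_pure (tright x)))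
  end.

Lemma HNAs_lift_multilinear t : multilinear (@HNAs_lift_pure t).
Proof.
elim: t => [|k l IHl r IHr] i a x x1 x2 H /=.
  by move: H; rewrite [i]ord1 /thead -linearP => -[->].
rewrite /= in i x x1 x2 H *.
(* The varied entry lies in exactly one of the two subtrees; the outer iterates of [tw] preserve
   linearity. *)
elim: k {i H} (lin_at_split H) => [|k IHk] H /=; last first.
  by rewrite IHk // linearP.
case: H => [[j [H [e1 e2]]]|[j [H [e1 e2]]]]; rewrite e1 e2.
  by rewrite (IHl _ _ _ _ _ H) linearDl linearZl_LR.
by rewrite (IHr _ _ _ _ _ H) linearPr.
Qed.

Definition HNAs_lift : HNAs V -> W := tslift HNAs_lift_pure.

Fact HNAs_lift_is_linear : linear HNAs_lift.
Proof. exact/tslift_linear/HNAs_lift_multilinear. Qed.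
HB.instance Definition _ := GRing.isLinear.Build K (HNAs V) W *:%R HNAs_lift
  HNAs_lift_is_linear.

Lemma HNAs_lift_pureE t x : HNAs_lift (pure t x) = HNAs_lift_pure x.
Proof. exact/tslift_pure/HNAs_lift_multilinear. Qed.

Lemma HNAs_lift_inj x : HNAs_lift (HNAs_inj x) = f x.
Proof. by rewrite HNAs_lift_pureE. Qed.

Lemma HNAs_liftM u v : HNAs_lift (HNAs_mul u v) = mu (HNAs_lift u) (HNAs_lift v).
Proof.
elim/tsum_ind: u => [|a s x u IHu]; first by rewrite !(linear0, linear0l).
rewrite !linearDl !linearZl_LR /= !linearP /= IHu linearDl linearZl_LR /=.
congr (_ *: _ + _) => {a u IHu}.
elim/tsum_ind: v => [|a t y v IHv]; first by rewrite !(linear0, linear0r).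
rewrite !linearP !linearPr /= linearP /= IHv; congr (_ *: _ + _) => {a v IHv}.
by rewrite HNAs_mulE !HNAs_lift_pureE /= tleft_cat tright_cat.
Qed.

Hypothesis twM : forall u v, tw (mu u v) = mu (tw u) (tw v).
Hypothesis fC : forall x, f (aV x) = tw (f x).

(** On a node, raising the root weight adds one iterate of [tw] by definition; on a leaf this is
    [fC]. *)
Lemma HNAs_liftC u : HNAs_lift (HNAs_tw aV u) = tw (HNAs_lift u).
Proof.
elim/tsum_ind: u => [|a t x u IHu]; first by rewrite !linear0.
rewrite !linearP /= IHu; congr (_ *: _ + _); rewrite HNAs_tw_pureE.
rewrite HNAs_lift_pureE; case: t x => [|k l r] x; rewrite /= HNAs_lift_pureE //=.
by rewrite /thead tnth_map fC.
Qed.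

(** Induction along the chain of ideals: [twM] kills the first generators, and commutation with the
    twist carries vanishing from each stage to its image under [HNAs_tw]. *)
Fact Minf_lift z : Minf aV z -> HNAs_lift z = 0.
Proof.
case=> n; elim: n z => [|n IHn]; apply: (ideal_ker HNAs_lift_is_linear HNAs_liftM).
  by move=> _ [u [v ->]]; rewrite linearB /= HNAs_liftC !HNAs_liftM !HNAs_liftC
    twM subrr.
by move=> z [/IHn//|[y /IHn y0 ->]]; rewrite HNAs_liftC y0 linear0.
Qed.

Lemma Fm_universal : exists F : {linear Fm aV -> W},
  [/\ forall x, F (Fm_inj aV x) = f x,
      forall u v, F (Fm_mul aV u v) = mu (F u) (F v)
    & forall u, F (Fm_tw aV u) = tw (F u)].
Proof.
have FL := qlift_linear HNAs_lift_is_linear Minf_lift.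
have FE := qlift_qpi HNAs_lift_is_linear Minf_lift.
pose F : {linear Fm aV -> W} :=
  HB.pack (qlift HNAs_lift) (GRing.isLinear.Build K (Fm aV) W *:%R _ FL).
exists F; split=> [x|u v|u] /=; first by rewrite FE HNAs_lift_inj.
  have [x ->] := qpi_surj u; have [y ->] := qpi_surj v.
  by rewrite Fm_mulE !FE HNAs_liftM.
by have [x ->] := qpi_surj u; rewrite Fm_twE !FE HNAs_liftC.
Qed.

End FmLift.

(** * Universal property of the enveloping Hom-associative algebra *)

Section UmLift.
Variables (K : fieldType) (g : homLieDer K).

Lemma iotaU_is_linear : linear (@iotaU K g).
Proof. by move=> a x y; rewrite /iotaU linearP qpiP. Qed.

Lemma iotaU_br x y :
  iotaU (hl_br x y)
    = ha_mul (iotaU x) (iotaU y) - ha_mul (iotaU y) (iotaU x) :> Um g.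
Proof.
rewrite /iotaU /= !Um_mulE -qpiB; apply/qpi_eqP; exact: Um_gen_br.
Qed.

Lemma iotaU_tw x : iotaU (hl_tw x) = ha_tw (iotaU x : Um g).
Proof. by rewrite /iotaU /= Um_twE Fm_tw_inj. Qed.

Lemma iotaU_der x : iotaU (hl_der x) = ha_der (iotaU x : Um g).
Proof. by rewrite /iotaU /= Um_derE Fm_der_inj. Qed.

Lemma Um_ind (P : Um g -> Prop) :
    P 0 -> (forall a (u v : Um g), P u -> P v -> P (a *: u + v)) ->
    (forall x, P (iotaU x)) ->
    (forall u v : Um g, P u -> P v -> P (ha_mul u v)) ->
    (forall u : Um g, P u -> P (ha_tw u)) ->
  forall u : Um g, P u.
Proof.
move=> P0 PL Pi PM PT u; have [{}u ->] := qpi_surj u.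
elim/Fm_ind: u => [|a u v Pu Pv|//|u v Pu Pv|u Pu].
- by rewrite linear0.
- by rewrite qpiP; apply: PL.
- by rewrite -Um_mulE; apply: PM.
- by rewrite -Um_twE; apply: PT.
Qed.

(** The image of [iotaU] generates [Um g] under linear combinations, products and the twist. *)
Lemma Um_morph_eq (A : homAsDer K) (f h : Um g -> A) :
  homAsDer_morph f -> homAsDer_morph h ->
  (forall x, f (iotaU x) = h (iotaU x)) -> f =1 h.
Proof.
move=> [fL fM fT _] [hL hM hT _] fh.
elim/Um_ind => [|a u v Hu Hv|//|u v Hu Hv|u Hu].
- by rewrite !linear_fun0.
- by rewrite fL hL Hu Hv.
- by rewrite fM hM Hu Hv.
- by rewrite fT hT Hu.
Qed.

(** The extension of [f] to the free algebra kills associators because [A] is Hom-associative, and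
    kills the bracket relations by the first condition on [f]. *)
Lemma Um_universal (A : homAsDer K) (f : {linear g -> A}) :
    (forall x y, f (hl_br x y) = ha_mul (f x) (f y) - ha_mul (f y) (f x)) ->
    (forall x, f (hl_tw x) = ha_tw (f x)) ->
    (forall x, f (hl_der x) = ha_der (f x)) ->
  exists F : Um g -> A, homAsDer_morph F /\ forall x, F (iotaU x) = f x.
Proof.
move=> fM fT fD.
have [F0 [F0i F0M F0T]] := Fm_universal (@ha_twM K A) fT.
have F0L : linear F0 by move=> a u v; rewrite linearP.
have F0I z : Um_ideal g z -> F0 z = 0.
  move: z; apply: (ideal_ker F0L F0M) => _ [[u [v [w ->]]]|[x [y ->]]].
    by rewrite linearB /= !F0M !F0T ha_assoc subrr.
  by rewrite 2!linearB /= !F0M !F0i fM subrr.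
have FE := qlift_qpi F0L F0I.
(* Both sides satisfy the same twisted Leibniz rule along [F0], so agreement spreads from the
   generators to the whole free algebra. *)
have F0D u : F0 (Fm_der (@hl_derC K g) u) = ha_der (F0 u).
  elim/Fm_ind: u => [|a u v Hu Hv|x|u v Hu Hv|u Hu].
  - by rewrite !linear0.
  - by rewrite !linearP /= Hu Hv.
  - by rewrite Fm_der_inj !F0i.
  - by rewrite Fm_derM linearD /= !F0M !F0T Hu Hv ha_derM.
  - by rewrite Fm_derC !F0T Hu ha_derC.
exists (qlift F0); split; last by move=> x; rewrite FE F0i.
split.
- exact: qlift_linear F0L F0I.
- move=> a b; have [x ->] := qpi_surj a; have [y ->] := qpi_surj b.
  by rewrite /= Um_mulE !FE F0M.
- by move=> a; have [x ->] := qpi_surj a; rewrite /= Um_twE !FE F0T.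
- by move=> a; have [x ->] := qpi_surj a; rewrite /= Um_derE !FE F0D.
Qed.

End UmLift.

(** * Extension of a linear map to the nonunital tensor algebra *)

Section TpLift.
Variables (K : fieldType) (V : lmodType K) (A : asDer K) (f : {linear V -> A}).

(** The first factor is kept apart because [A] may have no unit to serve as the empty product. *)
Fixpoint Tp_lift_seq (x : V) (s : seq V) : A :=
  if s is y :: s' then as_mul (f x) (Tp_lift_seq y s') else f x.

Definition Tp_lift_pure n (x : n.+1.-tuple V) : A :=
  Tp_lift_seq (thead x) (behead x).

Lemma Tp_lift_seq_cat x s y r :
  Tp_lift_seq x (s ++ y :: r) = as_mul (Tp_lift_seq x s) (Tp_lift_seq y r).
Proof. by elim: s x => [|z s IHs] x //=; rewrite IHs as_assoc. Qed.

Lemma Tp_lift_pureS n x y (t : n.-tuple V) :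
  Tp_lift_pure [tuple of x :: y :: t] =
    as_mul (f x) (Tp_lift_pure [tuple of y :: t]).
Proof. by rewrite /Tp_lift_pure !theadE. Qed.

Lemma Tp_lift_multilinear n : multilinear (@Tp_lift_pure n).
Proof.
elim: n => [|n IHn] i a t t1 t2.
  have E (x : 1.-tuple V) : Tp_lift_pure x = f (tnth x ord0).
    by case/tupleP: x => x s; rewrite [s]tuple0 tnth0.
  by rewrite !E [i]ord1 -linearP => -[->].
case/tupleP: t => x t; case/tupleP: t1 => x1 t1; case/tupleP: t2 => x2 t2.
(* If the varied entry is not the first, the heads agree and induction applies to the tails; if it
   is the first, the tails agree and linearity of [f] suffices. *)
case: (unliftP ord0 i) => [j ->|->] [Hi Hj]; rewrite ?tnth0 ?tnthS in Hi.
  have [e1 e2] := Hj ord0 isT; rewrite !tnth0 in e1 e2; subst x1 x2.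
  have {Hj}Hj k : k != j -> tnth t1 k = tnth t k /\ tnth t2 k = tnth t k.
    by move=> kj; have := Hj (lift ord0 k); rewrite !tnthS; apply;
      rewrite (inj_eq lift_inj).
  have {Hi Hj} := IHn j a t t1 t2 (conj Hi Hj).
  case/tupleP: t => y t; case/tupleP: t1 => y1 t1; case/tupleP: t2 => y2 t2.
  by rewrite !Tp_lift_pureS => ->; rewrite linearPr.
have tt1 : t1 = t.
  by apply: eq_from_tnth => k; have [] := Hj (lift ord0 k) isT; rewrite !tnthS.
have tt2 : t2 = t.
  by apply: eq_from_tnth => k; have [] := Hj (lift ord0 k) isT; rewrite !tnthS.
subst x t1 t2; case/tupleP: t {Hj} => y t.
by rewrite !Tp_lift_pureS linearP linearDl linearZl_LR.
Qed.

Definition Tp_lift : Tp V -> A := tslift Tp_lift_pure.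

Fact Tp_lift_is_linear : linear Tp_lift.
Proof. exact/tslift_linear/Tp_lift_multilinear. Qed.
HB.instance Definition _ := GRing.isLinear.Build K (Tp V) A *:%R Tp_lift
  Tp_lift_is_linear.

Lemma Tp_lift_pureE n x : Tp_lift (@pure K V nat S n x) = Tp_lift_pure x.
Proof. exact/tslift_pure/Tp_lift_multilinear. Qed.

Lemma Tp_lift_inj x : Tp_lift (Tp_inj x) = f x.
Proof. by rewrite Tp_lift_pureE. Qed.

Lemma Tp_liftM u v : Tp_lift (Tp_mul u v) = as_mul (Tp_lift u) (Tp_lift v).
Proof.
elim/tsum_ind: u => [|a m x u IHu]; first by rewrite !(linear0, linear0l).
rewrite !linearDl !linearZl_LR /= !linearP /= IHu linearDl linearZl_LR /=.
congr (_ *: _ + _) => {a u IHu}.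
elim/tsum_ind: v => [|a n y v IHv]; first by rewrite !(linear0, linear0r).
rewrite !linearP !linearPr /= linearP /= IHv; congr (_ *: _ + _) => {a v IHv}.
rewrite Tp_mulE !Tp_lift_pureE /Tp_lift_pure.
case/tupleP: x => x s; case/tupleP: y => y r.
by rewrite !theadE /= -Tp_lift_seq_cat.
Qed.

End TpLift.

(** * Universal property of the nonunital enveloping algebra *)

Section UpLift.
Variables (K : fieldType) (L : lieDer K).

Lemma iota0_is_linear : linear (@iota0 K L).
Proof. by move=> a x y; rewrite /iota0 linearP qpiP. Qed.

Lemma iota0_br x y :
  iota0 (li_br x y)
    = as_mul (iota0 x) (iota0 y) - as_mul (iota0 y) (iota0 x) :> Up L.
Proof.
rewrite /iota0 /= !Up_mulE -qpiB; apply/esym/qpi_eqP; exact: Up_gen_br.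
Qed.

Lemma Up_ind (P : Up L -> Prop) :
    P 0 -> (forall a (u v : Up L), P u -> P v -> P (a *: u + v)) ->
    (forall x, P (iota0 x)) ->
    (forall u v : Up L, P u -> P v -> P (as_mul u v)) ->
  forall u : Up L, P u.
Proof.
move=> P0 PL Pi PM u; have [{}u ->] := qpi_surj u.
elim/Tp_ind: u => [|a u v Pu Pv|//|u v Pu Pv].
- by rewrite linear0.
- by rewrite qpiP; apply: PL.
- by rewrite -Up_mulE; apply: PM.
Qed.

Lemma Up_morph_eq (A : lmodType K) (m : A -> A -> A) (f h : Up L -> A) :
  linear f -> linear h ->
  (forall u v, f (as_mul u v) = m (f u) (f v)) ->
  (forall u v, h (as_mul u v) = m (h u) (h v)) ->
  (forall x, f (iota0 x) = h (iota0 x)) -> f =1 h.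
Proof.
move=> fL hL fM hM fh.
elim/Up_ind => [|a u v Hu Hv|//|u v Hu Hv].
- by rewrite !linear_fun0.
- by rewrite fL hL Hu Hv.
- by rewrite fM hM Hu Hv.
Qed.

Lemma Up_universal (A : asDer K) (f : {linear L -> A}) :
    (forall x y, f (li_br x y) = as_mul (f x) (f y) - as_mul (f y) (f x)) ->
    (forall x, f (li_der x) = as_der (f x)) ->
  exists F : Up L -> A, asDer_morph F /\ forall x, F (iota0 x) = f x.
Proof.
move=> fM fD; have F0L := Tp_lift_is_linear f.
have FI : forall z, Up_ideal L z -> Tp_lift f z = 0.
  apply: (ideal_ker F0L (Tp_liftM f)) => _ [x [y ->]].
  by rewrite !linearB /= !Tp_liftM !Tp_lift_inj fM subrr.
have FE := qlift_qpi F0L FI.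
have F0D u : Tp_lift f (Tp_der li_der u) = as_der (Tp_lift f u).
  elim/Tp_ind: u => [|a u v Hu Hv|x|u v Hu Hv].
  - by rewrite !linear0.
  - by rewrite !linearP /= Hu Hv.
  - by rewrite Tp_der_inj !Tp_lift_inj.
  - by rewrite Tp_derM linearD /= !Tp_liftM Hu Hv as_derM.
exists (qlift (Tp_lift f)); split; last by move=> x; rewrite FE Tp_lift_inj.
split.
- exact: qlift_linear F0L FI.
- move=> a b; have [x ->] := qpi_surj a; have [y ->] := qpi_surj b.
  by rewrite /= Up_mulE !FE Tp_liftM.
- by move=> a; have [x ->] := qpi_surj a; rewrite /= Up_derE !FE F0D.
Qed.

End UpLift.

(** * Transfer of morphisms between twisted and untwisted structures *)

Section TwistUntwist.
Variables (K : fieldType) (A : homAsDer K) (bA : bijective (@ha_tw K A)).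

Lemma untwist_twM (a b : untwist bA) :
  ha_tw (as_mul a b : A) = as_mul (ha_tw (a : A) : untwist bA) (ha_tw (b : A)).
Proof. by apply: (bij_inj bA); rewrite /= /untwist_mul !bij_invKV ha_twM. Qed.

Variables (B : asDer K) (h : {linear B -> B}).
Hypothesis hM : forall a b, h (as_mul a b) = as_mul (h a) (h b).
Hypothesis hC : forall a, as_der (h a) = h (as_der a).

(* Every element of A is a value of ha_tw, so h need not be injective. *)
Lemma morph_untwist (f : A -> yau_twist hM hC) :
  homAsDer_morph f -> @asDer_morph K (untwist bA) B f.
Proof.
case=> fL fM fT fD; split=> // [a b|a] /=.
  rewrite -[a](bij_invKV bA) -[b](bij_invKV bA); set a' := bij_inv _ a.
  set b' := bij_inv _ b.
  by rewrite /untwist_mul -ha_twM bij_invK !fT fM /= /twist_mul hM.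
rewrite -[a](bij_invKV bA); set a' := bij_inv _ a.
by rewrite /untwist_der ha_derC bij_invK !fT fD /= /twist_der hC.
Qed.

(** The twist created by [h] cancels the inverse twist in the untwisted product and derivation once
    [f] intertwines [h] with [ha_tw]. *)
Lemma morph_twist (f : B -> untwist bA) :
    asDer_morph f -> (forall b, f (h b) = ha_tw (f b : A)) ->
  @homAsDer_morph K (yau_twist hM hC) A f.
Proof.
move=> [fL fM fD] fT; split=> //= [a b|a].
  by rewrite /twist_mul fT fM /= /untwist_mul bij_invKV.
by rewrite /twist_der fT fD /= /untwist_der bij_invKV.
Qed.

End TwistUntwist.
Arguments morph_twist {K A bA B h hM hC f}.

(** * The two inverse isomorphisms *)

Theorem theorem4p8 (K : fieldType) (charK : [pchar K]%R =i pred0)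
    (g : homLieDer K) (alpha_bij : bijective (@hl_tw K g)) :
  exists Phi : Um g -> Uplus_twisted alpha_bij,
    unique (fun Psi : Um g -> Uplus_twisted alpha_bij =>
              homAsDer_iso Psi /\
              forall x : g, Psi (iotaU x) = @iota0 K (g0 alpha_bij) x) Phi /\
    @asDer_iso K (untwist (Um_tw_bij alpha_bij)) (Up (g0 alpha_bij)) Phi.
Proof.
set T := Uplus_twisted alpha_bij; set U := untwist _; set L := g0 alpha_bij.
(* [g] and [L] share one underlying space, as do [Up L] and [T], and [Um g] and [U]; only the
   recorded structure changes. *)
pose i0 : {linear g -> T} :=
  HB.pack (@iota0 K L) (GRing.isLinear.Build K L (Up L) *:%R _ (@iota0_is_linear K L)).
pose iU : {linear L -> U} :=
  HB.pack (@iotaU K g) (GRing.isLinear.Build K g (Um g) *:%R _ (@iotaU_is_linear K g)).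
have twT x : ha_tw (i0 x) = i0 (hl_tw x) by apply: (@Up_map_iota K L).
(* The operations of [L] are those of [g] followed by the inverse of alpha; applying the twist of
   [T] undoes that inverse. *)
have i0K (x : g) : @ha_tw K T (i0 (bij_inv alpha_bij x)) = i0 x.
  by rewrite twT bij_invKV.
have i0_br x y :
    i0 (hl_br x y) = ha_mul (i0 x) (i0 y) - ha_mul (i0 y) (i0 x).
  rewrite -i0K; transitivity (@ha_tw K T
    (@as_mul K (Up L) (i0 x) (i0 y) - @as_mul K (Up L) (i0 y) (i0 x))).
    congr (ha_tw _); exact: (@iota0_br K L).
  exact: linearB.
have i0_der x : i0 (hl_der x) = ha_der (i0 x).
  rewrite -i0K; congr (@ha_tw K T _); exact/esym/(@Up_der_iota K L).
have [Phi [PhiM PhiI]] := Um_universal i0_br (fun x => esym (twT x)) i0_der.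
(* This turns the inverse of alpha in the operations of [L] into the inverse twist in those of
   [U]. *)
have iUinv x : iotaU (bij_inv alpha_bij x) =
    bij_inv (Um_tw_bij alpha_bij) (iotaU x : Um g).
  by apply: (bij_inj (Um_tw_bij alpha_bij)); rewrite -iotaU_tw !bij_invKV.
have [Psi [PsiM PsiI]] : exists F : Up L -> U,
    asDer_morph F /\ forall x, F (iota0 x) = iU x.
  apply: Up_universal => [x y|x] /=.
    by rewrite /g0_br /untwist_mul iUinv iotaU_br linearB.
  by rewrite /g0_der /untwist_der iUinv iotaU_der.
(* [Psi] was built from untwisted data only, so its compatibility with the twists is checked on
   generators; both twists are multiplicative for the untwisted products. *)
have PsiT b : Psi (@ha_tw K T b) = @ha_tw K (Um g) (Psi b).
  have [PL PM _] := PsiM.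
  elim/Up_ind: b => [|a u v Hu Hv|x|u v Hu Hv].
  - by rewrite !(linear0, linear_fun0 PL).
  - by rewrite linearP !PL Hu Hv linearP.
  - by rewrite (twT x) !PsiI -iotaU_tw.
  - by rewrite [ha_tw _](Up_mapM (@g0_twM _ _ alpha_bij)) !PM Hu Hv -untwist_twM.
have PhiA := morph_untwist (Um_tw_bij alpha_bij) PhiM.
have PsiH : @homAsDer_morph K T (Um g) Psi := morph_twist PsiM PsiT.
(* The composite is an endomorphism of [Um g] fixing every [iotaU x], hence the identity. *)
have PhiK : cancel Phi Psi.
  have [F1 F2 F3 F4] := PhiM; have [P1 P2 P3 P4] := PsiH.
  apply: Um_morph_eq => [|//|x]; last by rewrite PhiI PsiI.
  split=> [a u v|u v|u|u].
  - by rewrite F1 P1.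
  - by rewrite F2 P2.
  - by rewrite F3 P3.
  - by rewrite F4 P4.
(* Here both maps are taken as morphisms for the untwisted products, and the composite fixes every
   [iota0 x]. *)
have PsiK : cancel Psi Phi.
  have [F1 F2 _] := PhiA; have [P1 P2 _] := PsiM.
  apply: (@Up_morph_eq K L (Up L) as_mul) => [a u v|//|u v|//|x].
  - by rewrite P1 F1.
  - by rewrite P2 F2.
  - by rewrite PsiI PhiI.
exists Phi; split; last by split=> //; exists Psi.
split; first by split=> //; split=> //; exists Psi.
move=> F [[FM _] FI]; apply: funext => u.
by apply: Um_morph_eq u => // x; rewrite FI PhiI.
Qed.
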